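(* Let $\mathcal{G}$ be an ample Hausdorff groupoid with compact unit space $\mathcal{G}^{(0)}$. The representation $\pi\colon \mathbb{C}F(\mathcal{G}) \to A(\mathcal{G})$, $\pi(\delta_U)=1_U$, of the topological full group of $\mathcal{G}$ in its complex Steinberg algebra is an isomorphism if and only if $\mathcal{G}$ is a group. Similarly, if $\mathcal{G}$ is discrete, then the extension $\overline{\pi}_{\max}\colon C^*(F(\mathcal{G})) \to C^*(\mathcal{G})$ of $\pi$ is an isomorphism if and only if $\mathcal{G}$ is a group.
   Context: A groupoid $\mathcal{G}$ is a small category in which every morphism is invertible, identified with its set of morphisms; all groupoids are assumed nonempty. Range and source are $r(\gamma)=\gamma\gamma^{-1}$, $s(\gamma)=\gamma^{-1}\gamma$; $\alpha\beta$ is defined if and only if $s(\alpha)=r(\beta)$; the unit space is $\mathcal{G}^{(0)}=r(\mathcal{G})=s(\mathcal{G})$. A groupoid is a group if and only if $\mathcal{G}^{(0)}$ is a singleton. A topological groupoid is a groupoid with a topology making composition and inversion continuous. A Hausdorff groupoid is a topological groupoid whose topology is locally compact Hausdorff. It is étale if $r,s\colon\mathcal{G}\to\mathcal{G}^{(0)}$ are local homeomorphisms. A bisection is a subset $B\subseteq\mathcal{G}$ on which $r$ and $s$ are both injective. An étale groupoid is ample if its topology has a basis of compact open bisections. For an ample Hausdorff groupoid $\mathcal{G}$, the complex Steinberg algebra $A(\mathcal{G})$ is the span of the characteristic functions $1_U\colon\mathcal{G}\to\mathbb{C}$ of compact open bisections $U$ of $\mathcal{G}$ (equivalently, the locally constant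 compactly supported functions $\mathcal{G} \to \mathbb{C}$), with convolution $(f*g)(\gamma)=\sum_{\alpha\beta=\gamma}f(\alpha)g(\beta)$ and involution $f^*(\gamma)=\overline{f(\gamma^{-1})}$. The same operations make the space $C_c(\mathcal{G})$ of continuous compactly supported functions $\mathcal{G}\to\mathbb{C}$ a $*$-algebra containing $A(\mathcal{G})$. The full groupoid C*-algebra $C^*(\mathcal{G})$ is the completion of $C_c(\mathcal{G})$ in the norm $\|f\|_{\mathrm{max}}=\sup\{\|\rho(f)\| : \rho\colon C_c(\mathcal{G})\to B(\mathcal{H}) \text{ is a } *\text{-representation for some Hilbert space } \mathcal{H}\}$. If $\mathcal{G}^{(0)}$ is compact, the topological full group $F(\mathcal{G})$ is the (discrete) group of all compact open bisections $B$ of $\mathcal{G}$ that are full, i.e. $r(B)=s(B)=\mathcal{G}^{(0)}$, with product $AB=\{\alpha\beta : \alpha\in A,\ \beta\in B,\ s(\alpha)=r(\beta)\}$ and inverse $B^{-1}=\{\gamma^{-1} : \gamma\in B\}$. The complex group ring $\mathbb{C}F(\mathcal{G})$ has basis $\{\delta_U : U\in F(\mathcal{G})\}$, and $\pi\colon\mathbb{C}F(\mathcal{G})\to A(\mathcal{G})$ is the $*$-homomorphism that is the linear extension of $\delta_U\mapsto 1_U$. $C^*(F(\mathcal{G}))$ is the full group C*-algebra of the discrete group $F(\mathcal{G})$, and $\overline{\pi}_{\max}$ is the unique $*$-homomorphism $C^*(F(\mathcal{G}))\to C^*(\mathcal{G})$ extending $\pi$ (regarded as a map into $C^*(\mathcal{G})\supseteq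 A(\mathcal{G})$). *)

(* Defs.v *)
From HB Require Import structures.
From mathcomp Require Import all_boot all_order all_algebra.
From mathcomp Require Import sesquilinear complex.
From mathcomp Require Import all_classical all_reals all_analysis.

Set Implicit Arguments.
Unset Strict Implicit.
Unset Printing Implicit Defensive.

Import Order.TTheory GRing.Theory Num.Theory numFieldNormedType.Exports.

Local Open Scope classical_set_scope.
Local Open Scope ring_scope.

(** * Groupoids *)

(* The carrier is the set of morphisms.  [gmul a b] is meaningful only when
   [gsrc a = grng b]; its value on other pairs is arbitrary and never used. *)
HB.mixin Record isGroupoid G & Choice G := {
  gmul : G -> G -> G;
  ginv : G -> G;
  grng : G -> G;
  gsrc : G -> G;
  groupoid_inhabited : inhabited G;
  grngE : forall a, grng a = gmul a (ginv a);
  gsrcE : forall a, gsrc a = gmul (ginv a) a;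
  grngM : forall a b, gsrc a = grng b -> grng (gmul a b) = grng a;
  gsrcM : forall a b, gsrc a = grng b -> gsrc (gmul a b) = gsrc b;
  gmulA : forall a b c, gsrc a = grng b -> gsrc b = grng c ->
    gmul (gmul a b) c = gmul a (gmul b c);
  grngV : forall a, grng (ginv a) = gsrc a;
  gsrcV : forall a, gsrc (ginv a) = grng a;
  gmul_rng : forall a, gmul (grng a) a = a;
  gmul_src : forall a, gmul a (gsrc a) = a
}.

#[short(type="groupoidType")]
HB.structure Definition Groupoid := {G of Choice G & isGroupoid G}.

Section GroupoidDefs.
Variable G : groupoidType.
Implicit Types A B : set G.

Definition units : set G := range (@grng G).

Definition is_group : Prop := exists e : G, units = [set e].

Definition bisection B : Prop := set_inj B (@grng G) /\ set_inj B (@gsrc G).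

Definition set_gmul A B : set G :=
  [set c | exists a b, [/\ A a, B b, gsrc a = grng b & c = gmul a b]].

Definition set_ginv B : set G := [set ginv b | b in B].

End GroupoidDefs.
Arguments units G : clear implicits.
Arguments is_group G : clear implicits.

(** * Ample Hausdorff groupoids *)

(* The last condition says that f restricts to an open map on U: together with
   injectivity and continuity on U this makes f a homeomorphism from U onto an
   open subset of Y. *)
Definition local_homeomorphism (X Y : topologicalType) (f : X -> Y) : Prop :=
  forall x, exists U : set X, [/\ open_nbhs x U, set_inj U f,
    {within U, continuous f} &
    forall W, open W -> W `<=` U -> open (f @` W)].

HB.mixin Record isTopologicalGroupoid G & Groupoid G & Topological G := {
  ginv_continuous : continuous (@ginv G);
  gmul_continuous :
    {within [set p : G * G | gsrc p.1 = grng p.2],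
      continuous (fun p => gmul p.1 p.2)}
}.

#[short(type="topologicalGroupoidType")]
HB.structure Definition TopologicalGroupoid :=
  {G of Groupoid G & Topological G & isTopologicalGroupoid G}.

HB.mixin Record TopologicalGroupoid_isHausdorff G & TopologicalGroupoid G := {
  groupoid_hausdorff : hausdorff_space G;
  groupoid_locally_compact : locally_compact [set: G]
}.

#[short(type="hausdorffGroupoidType")]
HB.structure Definition HausdorffGroupoid :=
  {G of TopologicalGroupoid G & TopologicalGroupoid_isHausdorff G}.

(* [subspace (units G)] is G retopologised so that the sets of units that are
   open in it are exactly the relatively open subsets of the unit space. *)
HB.mixin Record HausdorffGroupoid_isAmple G & HausdorffGroupoid G := {
  grng_local_homeo :
    local_homeomorphism (@grng G : G -> subspace (units G));
  gsrc_local_homeo :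
    local_homeomorphism (@gsrc G : G -> subspace (units G));
  ample_basis : basis [set B : set G | [/\ compact B, open B & bisection B]]
}.

#[short(type="ampleGroupoidType")]
HB.structure Definition AmpleGroupoid :=
  {G of HausdorffGroupoid G & HausdorffGroupoid_isAmple G}.

(** * The topological full group *)

Definition full_bisection (G : topologicalGroupoidType) (B : set G) : Prop :=
  [/\ compact B, open B, bisection B,
      @grng G @` B = units G & @gsrc G @` B = units G].

Section GroupoidTheory.
Variable G : groupoidType.
Implicit Types (a b c : G) (A B C : set G).

Lemma gsrc_rng a : gsrc (grng a) = grng a.
Proof. by rewrite [in LHS](grngE a) gsrcM ?gsrcV // grngV. Qed.

Lemma grng_rng a : grng (grng a) = grng a.
Proof. by rewrite [in LHS](grngE a) grngM // grngV. Qed.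

Lemma grng_src a : grng (gsrc a) = gsrc a.
Proof. by rewrite -grngV grng_rng. Qed.

Lemma gsrc_src a : gsrc (gsrc a) = gsrc a.
Proof. by rewrite -(grngV a) gsrc_rng. Qed.

Lemma units_rng a : units G (grng a). Proof. by exists a. Qed.

Lemma units_src a : units G (gsrc a). Proof. by exists (ginv a); rewrite ?grngV. Qed.

Lemma units_rngE a : units G a -> grng a = a.
Proof. by move=> [b _ <-]; exact: grng_rng. Qed.

Lemma units_srcE a : units G a -> gsrc a = a.
Proof. by move=> [b _ <-]; exact: gsrc_rng. Qed.

Lemma gmulK a b : gsrc a = grng b -> gmul (ginv a) (gmul a b) = b.
Proof.
by move=> ab; rewrite -gmulA ?gsrcV // -?gsrcE ?ab ?gmul_rng.
Qed.

Lemma gmulVK a b : grng a = grng b -> gmul a (gmul (ginv a) b) = b.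
Proof.
by move=> ab; rewrite -gmulA ?gsrcV ?grngV // -grngE ab gmul_rng.
Qed.

Lemma ginvK a : ginv (ginv a) = a.
Proof.
have := @gmulK (ginv a) a; rewrite gsrcV => /(_ erefl).
by rewrite -gsrcE -{1}(grngV a) -(gsrcV (ginv a)) gmul_src.
Qed.

End GroupoidTheory.

Section SetProducts.
Variable G : groupoidType.
Implicit Types (a b c : G) (A B C : set G).

Lemma set_gmulA A B C : set_gmul A (set_gmul B C) = set_gmul (set_gmul A B) C.
Proof.
apply/seteqP; split=> x.
  move=> [a [_ [Aa [b [c [Bb Cc bc ->]]]]]]; rewrite grngM // => ab ->.
  exists (gmul a b), c; split=> //; first by exists a, b.
    by rewrite gsrcM.
  by rewrite gmulA.
move=> [_ [c [[a [b [Aa Bb ab ->]]] Cc]]]; rewrite gsrcM // => bc ->.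
exists a, (gmul b c); split=> //; first by exists b, c.
  by rewrite grngM.
by rewrite gmulA.
Qed.

Lemma set_gmul1 A : set_gmul (units G) A = A.
Proof.
apply/seteqP; split=> x.
  by move=> [u [a [/units_srcE Uu Aa ua ->]]]; rewrite -Uu ua gmul_rng.
move=> Ax; exists (grng x), x; split=> //; first exact: units_rng.
  exact: gsrc_rng.
by rewrite gmul_rng.
Qed.

Lemma set_gmulr1 A : set_gmul A (units G) = A.
Proof.
apply/seteqP; split=> x.
  by move=> [a [u [Aa /units_rngE Uu au ->]]]; rewrite -Uu -au gmul_src.
move=> Ax; exists x, (gsrc x); split=> //; first exact: units_src.
  by rewrite grng_src.
by rewrite gmul_src.
Qed.

Lemma set_gmulV A : bisection A -> @gsrc G @` A = units G ->
  set_gmul (set_ginv A) A = units G.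
Proof.
move=> [Ar As] sA; apply/seteqP; split=> x.
  move=> [_ [a [[b Ab <-] Aa]]]; rewrite gsrcV => ba ->.
  by rewrite (Ar b a) ?inE // -gsrcE; exact: units_src.
rewrite -{1}sA => -[a Aa <-]; exists (ginv a), a; split=> //.
- by exists a.
- by rewrite gsrcV.
- by rewrite gsrcE.
Qed.

Lemma set_gmulVr A : bisection A -> @grng G @` A = units G ->
  set_gmul A (set_ginv A) = units G.
Proof.
move=> [Ar As] sA; apply/seteqP; split=> x.
  move=> [b [_ [Ab [a Aa <-]]]]; rewrite grngV => ba ->.
  by rewrite (As b a) ?inE // -grngE; exact: units_rng.
rewrite -{1}sA => -[a Aa <-]; exists a, (ginv a); split=> //.
- by exists a.
- by rewrite grngV.
- by rewrite grngE.
Qed.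

Lemma bisection_gmul A B : bisection A -> bisection B ->
  bisection (set_gmul A B).
Proof.
move=> [Ar As] [Br Bs]; split=> x y; rewrite !inE.
  move=> [a [b [Aa Bb ab ->]]] [a' [b' [Aa' Bb' ab' ->]]].
  rewrite !grngM // => /Ar aa'; have {aa'}aa' : a = a' by apply: aa'; rewrite inE.
  by subst a'; congr gmul; apply: Br; rewrite ?inE // -ab -ab'.
move=> [a [b [Aa Bb ab ->]]] [a' [b' [Aa' Bb' ab' ->]]].
rewrite !gsrcM // => /Bs bb'; have {bb'}bb' : b = b' by apply: bb'; rewrite inE.
by subst b'; congr gmul; apply: As; rewrite ?inE // ab ab'.
Qed.

Lemma bisection_ginv A : bisection A -> bisection (set_ginv A).
Proof.
move=> [Ar As]; split=> x y; rewrite !inE => -[a Aa <-] [b Ab <-].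
  by rewrite !grngV => /As -> //; rewrite inE.
by rewrite !gsrcV => /Ar -> //; rewrite inE.
Qed.

End SetProducts.

Section FullBisections.
Variable G : ampleGroupoidType.
Implicit Types (a b c : G) (A B : set G).


Lemma gmul_cvg (T : Type) (F : set_system T) (f g : T -> G) a b : Filter F ->
  gsrc a = grng b -> (\forall t \near F, gsrc (f t) = grng (g t)) ->
  f @ F --> a -> g @ F --> b -> (fun t => gmul (f t) (g t)) @ F --> gmul a b.
Proof.
move=> FF ab Ffg Ffa Fgb.
have /subspace_continuousP/(_ (a, b) ab) := @gmul_continuous G.
move=> /= cab V /cab /= [[P Q] /= [Pa Qb] PQV].
have fP := Ffa _ Pa; have gQ := Fgb _ Qb.
rewrite /nbhs/=; near=> t; apply: (PQV (f t, g t)) => /=; last by near: t.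
by split; near: t.
Unshelve. all: by end_near. Qed.

Lemma grng_continuous : continuous (@grng G).
Proof.
move=> a; have -> : @grng G = fun b => gmul b (ginv b).
  by apply/funext => b; rewrite grngE.
apply: gmul_cvg; rewrite ?grngV //; first by apply: nearW => b; rewrite grngV.
exact: ginv_continuous.
Qed.

Lemma gsrc_continuous : continuous (@gsrc G).
Proof.
move=> a; have -> : @gsrc G = fun b => gmul (ginv b) b.
  by apply/funext => b; rewrite gsrcE.
apply: gmul_cvg; rewrite ?gsrcV //; first by apply: nearW => b; rewrite gsrcV.
exact: ginv_continuous.
Qed.

Lemma open_units : open (units G).
Proof.
rewrite openE => u Uu.
have [U [[oU Ua] iU _ _]] := @grng_local_homeo G u.
have Uu' : nbhs u U by exact: open_nbhs_nbhs.
have rU : nbhs u (@grng G @^-1` U).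
  by apply: grng_continuous; rewrite units_rngE.
rewrite /interior; near=> a.
exists a => //; apply: iU; rewrite ?inE ?grng_rng //.
  by near: a.
by near: a.
Unshelve. all: by end_near. Qed.

Lemma ginv_preimage A : set_ginv A = @ginv G @^-1` A.
Proof.
apply/seteqP; split=> a /=; first by move=> [b Ab <-]; rewrite ginvK.
by move=> Aa; exists (ginv a); rewrite ?ginvK.
Qed.

Lemma open_ginv A : open A -> open (set_ginv A).
Proof.
rewrite ginv_preimage; apply: open_comp => a _; exact: ginv_continuous.
Qed.

Lemma compact_ginv A : compact A -> compact (set_ginv A).
Proof.
apply: continuous_compact; apply: continuous_subspaceT.
exact: ginv_continuous.
Qed.

Lemma compact_gmul A B : compact A -> compact B -> compact (set_gmul A B).
Proof.
move=> cA cB; pose D := [set p : G * G | gsrc p.1 = grng p.2].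
have clD : closed D.
  move=> p Dp; apply: (@groupoid_hausdorff G) => U V Up Vp.
  have cs : gsrc q.1 @[q --> p] --> gsrc p.1.
    by apply: (cvg_comp fst (@gsrc G)); [exact: cvg_fst|exact: gsrc_continuous].
  have cr : grng q.2 @[q --> p] --> grng p.2.
    by apply: (cvg_comp snd (@grng G)); [exact: cvg_snd|exact: grng_continuous].
  have Us : nbhs p [set q | U (gsrc q.1)] := cs U Up.
  have Vr : nbhs p [set q | V (grng q.2)] := cr V Vp.
  have [q [/= Dq [Uq Vq]]] := Dp _ (filterI Us Vr).
  by exists (gsrc q.1); split=> //; rewrite Dq.
have cAB : compact ((A `*` B) `&` D).
  by apply: compact_closedI => //; exact: compact_setX.
have -> : set_gmul A B = (fun p : G * G => gmul p.1 p.2) @` ((A `*` B) `&` D).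
  apply/seteqP; split=> c.
    by move=> [a [b [Aa Bb ab ->]]]; exists (a, b).
  by move=> [[a b] /= [[Aa Bb] ab] <-]; exists a, b.
apply: continuous_compact => //.
apply: (@continuous_subspaceW _ _ _ D); first by move=> p [].
exact: gmul_continuous.
Qed.

Lemma open_gmul A B : open A -> open B -> open (set_gmul A B).
Proof.
move=> oA oB; rewrite openE => _ [a [b [Aa Bb ab ->]]]; rewrite /interior.
have [U [[oU Ua] iU _ opU]] := @grng_local_homeo G a.
pose V := A `&` U.
have oV : open V by exact: openI.
have Va : V a by [].
(* the local section of the range map on the range of V *)
pose sec c := xget a [set d | V d /\ grng d = grng c].
have secE d c : V d -> grng d = grng c -> sec c = d.
  move=> Vd dc; rewrite /sec; case: xgetP => [e _ [Ve ec]|/(_ d)[]//].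
  by apply: iU; rewrite ?inE ?ec -?dc //; [case: Ve|case: Vd].
pose g := gmul a b.
have rg : grng g = grng a by rewrite grngM.
have near_rng W : open W -> W `<=` U -> W a ->
    \forall c \near g, (@grng G @` W) (grng c).
  move=> oW WU Wa; have := opU W oW WU.
  rewrite openE => /(_ (grng a)) /= /(_ (imageP _ Wa)); rewrite /interior.
  rewrite /nbhs/= -nbhs_subspace_in; last exact: units_rng.
  rewrite -rg => /grng_continuous; rewrite /nbhs/=.
  by apply: filterS => c; apply; exact: units_rng.
have secg : sec g = a by exact: secE.
have csec : sec c @[c --> g] --> a.
  move=> W /=; rewrite nbhsE => -[W' [oW' W'a] W'W].
  have := near_rng (W' `&` V) (openI oW' oV).
  move=> /(_ _ (conj W'a Va)) h; have {}h := h (fun x p => p.2.2).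
  rewrite /nbhs/=; apply: filterS h => c [d [W'd Vd] dc].
  by rewrite /= (secE d c Vd dc); exact: W'W.
have rngc : \forall c \near g, (@grng G @` V) (grng c).
  by apply: near_rng => // x [].
have cB : (fun c => gmul (ginv (sec c)) c) @ g --> b.
  rewrite -[b](gmulK ab); apply: gmul_cvg.
  - by rewrite gsrcV.
  - apply: filterS rngc => c [d Vd dc].
    by rewrite (secE d c Vd dc) gsrcV.
  - apply: (cvg_comp sec ginv csec); exact: ginv_continuous.
  - exact: cvg_id.
have nB : \forall c \near g, B (gmul (ginv (sec c)) c).
  by apply: cB; exact: open_nbhs_nbhs.
near=> c.
have [d Vd dc] : (@grng G @` V) (grng c) by near: c.
have Bc : B (gmul (ginv (sec c)) c) by near: c.
move: Bc; rewrite (secE d c Vd dc) => Bc.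
exists d, (gmul (ginv d) c); split=> //.
- by case: Vd.
- by rewrite grngM ?grngV// gsrcV.
- by rewrite gmulVK.
Unshelve. all: by end_near. Qed.

Lemma rng_set_gmul A B : @grng G @` A = units G -> @gsrc G @` A = units G ->
  @grng G @` B = units G -> @grng G @` (set_gmul A B) = units G.
Proof.
move=> rA sA rB; apply/seteqP; split=> u; first by move=> [a _ <-]; exact: units_rng.
rewrite -{1}rA => -[a Aa <-].
have : units G (gsrc a) by exact: units_src.
rewrite -{1}rB => -[b Bb ba]; exists (gmul a b); last by rewrite grngM.
by exists a, b.
Qed.

Lemma src_set_gmul A B : @gsrc G @` A = units G ->
  @gsrc G @` B = units G -> @gsrc G @` (set_gmul A B) = units G.
Proof.
move=> sA sB; apply/seteqP; split=> u; first by move=> [a _ <-]; exact: units_src.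
rewrite -{1}sB => -[b Bb <-].
have : units G (grng b) by exact: units_rng.
rewrite -{1}sA => -[a Aa ab]; exists (gmul a b); last by rewrite gsrcM.
by exists a, b.
Qed.

Lemma full_bisection_gmul A B : full_bisection A -> full_bisection B ->
  full_bisection (set_gmul A B).
Proof.
move=> [cA oA bA rA sA] [cB oB bB rB sB]; split.
- exact: compact_gmul.
- exact: open_gmul.
- exact: bisection_gmul.
- exact: rng_set_gmul.
- exact: src_set_gmul.
Qed.

Lemma full_bisection_ginv A : full_bisection A -> full_bisection (set_ginv A).
Proof.
move=> [cA oA bA rA sA]; split.
- exact: compact_ginv.
- exact: open_ginv.
- exact: bisection_ginv.
- rewrite -sA; apply/seteqP; split=> u.
    by move=> [_ [a Aa <-] <-]; exists a; rewrite ?grngV.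
  by move=> [a Aa <-]; exists (ginv a); [exists a|rewrite grngV].
- rewrite -rA; apply/seteqP; split=> u.
    by move=> [_ [a Aa <-] <-]; exists a; rewrite ?gsrcV.
  by move=> [a Aa <-]; exists (ginv a); [exists a|rewrite gsrcV].
Qed.

Lemma full_bisection_units : compact (units G) -> full_bisection (units G).
Proof.
move=> cG; split=> //.
- exact: open_units.
- by split=> a b; rewrite !inE => Ua Ub;
    rewrite ?(units_rngE Ua) ?(units_rngE Ub) ?(units_srcE Ua) ?(units_srcE Ub).
- apply/seteqP; split=> u; first by move=> [a _ <-]; exact: units_rng.
  by move=> Uu; exists u => //; exact: units_rngE.
- apply/seteqP; split=> u; first by move=> [a _ <-]; exact: units_src.
  by move=> Uu; exists u => //; exact: units_srcE.
Qed.

End FullBisections.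

(* Compactness of the unit space is recorded in the type because the identity
   element, which is the unit space itself, must be a compact bisection. *)
Definition topFullGroup (G : ampleGroupoidType) (cG : compact (units G)) : Type :=
  {B : set G | `[< full_bisection B >]}.

Section TopologicalFullGroup.
Variables (G : ampleGroupoidType) (cG : compact (units G)).

Local Notation F := (topFullGroup cG).

HB.instance Definition _ :=
  SubChoice.copy F {B : set G | `[< full_bisection B >]}.

Lemma topFullGroupP (A : F) : full_bisection (val A).
Proof. by case: A => B /= /asboolP. Qed.

Definition tfg_one : F :=
  exist _ (units G) (asboolT (full_bisection_units cG)).

Definition tfg_inv (A : F) : F :=
  exist _ (set_ginv (val A))
    (asboolT (full_bisection_ginv (topFullGroupP A))).

Definition tfg_mul (A B : F) : F :=
  exist _ (set_gmul (val A) (val B))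
    (asboolT (full_bisection_gmul (topFullGroupP A) (topFullGroupP B))).

Lemma tfg_mulA : associative tfg_mul.
Proof. by move=> A B C; apply: val_inj; exact: set_gmulA. Qed.

Lemma tfg_mul1 : left_id tfg_one tfg_mul.
Proof. by move=> A; apply: val_inj; exact: set_gmul1. Qed.

Lemma tfg_mulr1 : right_id tfg_one tfg_mul.
Proof. by move=> A; apply: val_inj; exact: set_gmulr1. Qed.

Lemma tfg_mulV : left_inverse tfg_one tfg_inv tfg_mul.
Proof.
by move=> A; apply: val_inj; have [_ _ bA _ sA] := topFullGroupP A;
  exact: set_gmulV.
Qed.

Lemma tfg_mulVr : right_inverse tfg_one tfg_inv tfg_mul.
Proof.
by move=> A; apply: val_inj; have [_ _ bA rA _] := topFullGroupP A;
  exact: set_gmulVr.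
Qed.

HB.instance Definition _ :=
  isGroup.Build F tfg_mulA tfg_mul1 tfg_mulr1 tfg_mulV tfg_mulVr.

End TopologicalFullGroup.

(** * *-algebras, representations and C*-algebras *)

(* The complex numbers, packaged so that the norm topology of a
   [numClosedFieldType] is inferred. *)
Definition Cplx (R : realType) : numClosedFieldType := R[i]%C.

(* A *-algebra presented as a set of elements of an ambient complex vector
   space.  The operations are total on the ambient space, but are only ever
   used on elements of [sa_set]. *)
Record starAlgebraIn (R : realType) (V : lmodType (Cplx R)) := StarAlgebraIn {
  sa_set : set V;
  sa_mul : V -> V -> V;
  sa_star : V -> V
}.

Section StarHomomorphisms.
Variables (R : realType) (V W : lmodType (Cplx R)).
Variables (A : starAlgebraIn V) (B : starAlgebraIn W).
Implicit Types (f : V -> W) (u v : V).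

Definition star_hom f : Prop :=
  [/\ forall u, sa_set A u -> sa_set B (f u),
      forall (k : Cplx R) u v, sa_set A u -> sa_set A v ->
        f (k *: u + v) = k *: f u + f v,
      forall u v, sa_set A u -> sa_set A v ->
        f (sa_mul A u v) = sa_mul B (f u) (f v) &
      forall u, sa_set A u -> f (sa_star A u) = sa_star B (f u)].

Definition star_iso f : Prop :=
  star_hom f /\ set_bij (sa_set A) (sa_set B) f.

End StarHomomorphisms.

(* [hdot] is linear in its first and conjugate linear in its second variable. *)
HB.mixin Record isHilbert (R : realType) H
    & CompleteNormedModule (Cplx R) H := {
  hdot : {dot H for (@Num.conj (Cplx R))};
  hdotE : forall x : H, `|x| ^+ 2 = hdot x x
}.

#[short(type="hilbertType")]
HB.structure Definition Hilbert (R : realType) :=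
  {H of CompleteNormedModule (Cplx R) H & isHilbert R H}.

(* Possibly non-unital C*-algebras. *)
HB.mixin Record isCStarAlgebra (R : realType) A
    & CompleteNormedModule (Cplx R) A := {
  csmul : A -> A -> A;
  csstar : A -> A;
  csmulA : associative csmul;
  csmul_linearl : forall (k : Cplx R) (x y z : A),
    csmul (k *: x + y) z = k *: csmul x z + csmul y z;
  csmul_linearr : forall (k : Cplx R) (x y z : A),
    csmul z (k *: x + y) = k *: csmul z x + csmul z y;
  csstarK : involutive csstar;
  csstar_semilinear : forall (k : Cplx R) (x y : A),
    csstar (k *: x + y) = k^* *: csstar x + csstar y;
  csstarM : forall x y : A, csstar (csmul x y) = csmul (csstar y) (csstar x);
  csnormM : forall x y : A, `|csmul x y| <= `|x| * `|y|;
  csnorm_star : forall x : A, `|csmul (csstar x) x| = `|x| ^+ 2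
}.

#[short(type="cstarAlgebraType")]
HB.structure Definition CStarAlgebra (R : realType) :=
  {A of CompleteNormedModule (Cplx R) A & isCStarAlgebra R A}.

Definition full_starAlgebra (R : realType) (A : cstarAlgebraType R) :
  starAlgebraIn A := StarAlgebraIn setT (@csmul R A) (@csstar R A).

(* Norms of a normed module over the complex numbers are themselves complex
   numbers; this is the norm as a real number. *)
Definition real_norm (R : realType) (V : normedModType (Cplx R)) (x : V) : R :=
  complex.Re `|x|.

Definition bounded_operator (R : realType) (H : hilbertType R)
    (T : H -> H) : Prop :=
  exists M : R, forall x, real_norm (T x) <= M * real_norm x.

Definition operator_norm (R : realType) (H : hilbertType R)
    (T : H -> H) : \bar R :=
  ereal_sup [set (real_norm (T x))%:E | x in [set x | real_norm x <= 1]].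

Section MaximalNorm.
Variables (R : realType) (V : lmodType (Cplx R)) (A : starAlgebraIn V).

Definition star_representation (H : hilbertType R)
    (rho : V -> {linear H -> H}) : Prop :=
  [/\ forall u, sa_set A u -> bounded_operator (rho u),
      forall (k : Cplx R) u v, sa_set A u -> sa_set A v ->
        forall x, rho (k *: u + v) x = k *: rho u x + rho v x,
      forall u v, sa_set A u -> sa_set A v ->
        forall x, rho (sa_mul A u v) x = rho u (rho v x) &
      forall u, sa_set A u ->
        forall x y, hdot (rho (sa_star A u) x) y = hdot x (rho u y)].

Definition max_norm (u : V) : \bar R :=
  ereal_sup [set z | exists (H : hilbertType R) (rho : V -> {linear H -> H}),
    star_representation rho /\ z = operator_norm (rho u)].

(* A completion of A in the maximal norm, together with the canonical map. *)
Record max_completion := MaxCompletion {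
  completion_alg :> cstarAlgebraType R;
  completion_emb : V -> completion_alg;
  completion_emb_hom : star_hom A (full_starAlgebra completion_alg) completion_emb;
  completion_norm : forall u, sa_set A u ->
    (real_norm (completion_emb u))%:E = max_norm u;
  completion_dense : dense (completion_emb @` sa_set A)
}.

End MaximalNorm.

(** * The *-algebras of a discrete group and of an ample groupoid *)

(* The group ring: finitely supported functions, with [a] standing for the
   sum of the [a g * delta_g]. *)
Definition group_ring (R : realType) (F : groupType) :
    starAlgebraIn (F -> Cplx R) :=
  StarAlgebraIn
    [set a | finite_set [set g | a g != 0]]
    (fun a b g => \sum_(p \in [set p : F * F | (p.1 * p.2)%g = g])
                    (a p.1 * b p.2))
    (fun a g => (a (g^-1)%g)^*).

Section GroupoidAlgebras.
Variables (R : realType) (G : ampleGroupoidType).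
Implicit Types f g : G -> Cplx R.

Definition convolution f g : G -> Cplx R := fun c =>
  \sum_(p \in [set p : G * G | gsrc p.1 = grng p.2 /\ gmul p.1 p.2 = c])
     (f p.1 * g p.2).

Definition involution f : G -> Cplx R := fun c => (f (ginv c))^*.

Definition steinberg_algebra : starAlgebraIn (G -> Cplx R) :=
  StarAlgebraIn
    [set f | exists (n : nat) (k : 'I_n -> Cplx R) (U : 'I_n -> set G),
       (forall i, [/\ compact (U i), open (U i) & bisection (U i)]) /\
       f = \sum_(i < n) k i *: (\1_(U i) : G -> Cplx R)]
    convolution involution.

Definition compactly_supported_algebra : starAlgebraIn (G -> Cplx R) :=
  StarAlgebraIn
    [set f | continuous f /\
       exists2 K : set G, compact K & forall c, ~ K c -> f c = 0]
    convolution involution.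

End GroupoidAlgebras.

Section FullGroupRepresentation.
Variables (R : realType) (G : ampleGroupoidType) (cG : compact (units G)).

Definition full_group_ring := group_ring R (topFullGroup cG).

(* The linear extension of delta_U |-> 1_U. *)
Definition full_rep (a : topFullGroup cG -> Cplx R) : G -> Cplx R :=
  \sum_(U \in [set: topFullGroup cG]) a U *: (\1_(val U) : G -> Cplx R).

Lemma full_rep_delta (U : topFullGroup cG) : full_rep \1_[set U] = \1_(val U).
Proof.
rewrite /full_rep -(@fsbig_widen _ _ _ _ [set U])//; last first.
  by move=> V [_ /=] VU; rewrite indicE memNset ?scale0r.
by rewrite fsbig_set1 indicE mem_set// scale1r.
Qed.

End FullGroupRepresentation.

Definition groupoid_cstar (R : realType) (G : ampleGroupoidType) :=
  max_completion (compactly_supported_algebra R G).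

Section FullGroupRepresentationMax.
Variables (R : realType) (G : ampleGroupoidType) (cG : compact (units G)).

Definition full_group_cstar := max_completion (full_group_ring R cG).

(* The *-homomorphism between the completions extending [full_rep].  A
   *-homomorphism of C*-algebras is automatically continuous, so asking for
   continuity does not restrict the choice; with it, density of the group ring
   gives uniqueness at once.  The constant map is only the default value. *)
Definition full_rep_max (CF : full_group_cstar) (CG : groupoid_cstar R G) :
    CF -> CG :=
  xget (cst 0)
    [set phi : CF -> CG |
      [/\ star_hom (full_starAlgebra CF) (full_starAlgebra CG) phi,
          continuous phi &
          forall a, sa_set (full_group_ring R cG) a ->
            phi (completion_emb CF a) = completion_emb CG (full_rep a)]].

End FullGroupRepresentationMax.
Arguments full_group_cstar R {G} cG.
Arguments full_rep R {G} cG a.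
Arguments full_rep_max {R G cG} CF CG.

(* Main.v *)
Require Import Defs.
From HB Require Import structures.
From mathcomp Require Import all_boot all_order all_algebra.
From mathcomp Require Import all_classical all_reals all_analysis.
From mathcomp Require Import sesquilinear complex ring.

(** Both equivalences rest on one obstruction and one degenerate case.

    The obstruction. A full bisection meets every fibre of the range map in
    exactly one point, so for [a] in the group ring the function [full_rep a]
    has the same sum, namely the sum of the coefficients of [a], over the fibre
    of every unit ([fiber_sum_full_rep]). If there are two units [u <> v], then
    the characteristic function of a compact open set of units that contains
    [u] and not [v] has fibre sums 1 at [u] and 0 at [v]. It lies in the
    Steinberg algebra but not in the image of [full_rep]: surjectivity of
    [full_rep] alone forces the groupoid to be a group
    ([full_rep_surj_is_group]).

    For C*-algebras the same obstruction must be seen by a bounded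
    representation. If the groupoid is discrete its compact unit space is
    finite, with n points say, and [(rho f xi) u], the sum over the arrows [g]
    with range [u] of [f g * xi (source of g)], is a *-representation of the
    finitely supported functions on the n-dimensional Hilbert space. Applied to
    the constant vector 1 it returns the fibre sums of [f]. Hence [rho] maps
    the image of the group ring into the operators that send 1 to a multiple of
    1, whereas the characteristic function of [u] sends 1 to a basis vector; so
    this function has positive distance to the image of the group ring,
    uniformly in the maximal norm ([max_norm_full_rep_gap]). As the image of
    the group ring is dense in the image of the extension of [full_rep], the
    extension cannot be onto ([full_rep_max_surj_is_group]).

    The degenerate case. In a group [G] every bisection has at most one point,
    the topology is discrete, and the full bisections are exactly the
    singletons. Thus the topological full group is [G] itself, both the
    Steinberg algebra and the algebra of continuous compactly supported
    functions consist of the finitely supported functions, and [full_rep] is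
    the tautological isomorphism ([group_ring_iso]). An isomorphism of
    *-algebras preserves the maximal norm because representations are
    transported along it, and an isometry between dense subalgebras extends to
    the completions ([completion_iso]); the extension is [full_rep_max] because
    two continuous maps that agree on a dense set are equal. *)

Set Implicit Arguments.
Unset Strict Implicit.
Unset Printing Implicit Defensive.

Import Order.TTheory GRing.Theory Num.Theory numFieldNormedType.Exports.

Local Open Scope classical_set_scope.
Local Open Scope ring_scope.

(** * Finitely supported functions *)

(** Sums over a list with an indicator factor, unlike finitely supported sums
    over a set, can be exchanged with each other without finiteness side
    conditions. *)
Lemma fsum_seq (K : fieldType) (T : choiceType) (p : seq T) (P : pred T)
    (f : T -> K) :
  uniq p -> (forall x, f x != 0 -> x \in p) ->
  \sum_(x \in [set x | P x]) f x = \sum_(x <- p) f x * (P x)%:R.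
Proof.
move=> up fp; rewrite [RHS](fsbig_seq _ _ up).
rewrite [RHS](@fsbig_widen _ _ _ _ _ [set: T])//=; last first.
  move=> x [_ /= xp].
  have [->|/fp//] := eqVneq (f x) 0; by rewrite mul0r.
rewrite -[RHS](@fsbig_widen _ _ _ _ [set x | P x])//=.
  by apply: eq_fsbigr => x; rewrite inE /= => ->; rewrite mulr1.
by move=> x [_ /= /negP/negbTE ->]; rewrite mulr0.
Qed.

Lemma finsupp_seq (K : fieldType) (T : choiceType) (f : T -> K) :
  finite_set [set x | f x != 0] ->
  exists2 p : seq T, uniq p & forall x, f x != 0 -> x \in p.
Proof.
move=> ff; have [s sf] := (finite_seqP _).1 ff.
exists (undup s); first exact: undup_uniq.
move=> x fx; rewrite mem_undup.
by have : [set x | f x != 0] x by []; rewrite sf.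
Qed.

Lemma finsupp_lin (R : realType) (T : choiceType) (k : Cplx R)
    (f h : T -> Cplx R) :
  finite_set [set x | f x != 0] -> finite_set [set x | h x != 0] ->
  finite_set [set x | (k *: f + h) x != 0].
Proof.
move=> ff fh.
apply: (@sub_finite_set _ _ ([set x | f x != 0] `|` [set x | h x != 0])).
  move=> x /=.
  apply: contra_neqP => /not_orP[/negP/negPn/eqP f0 /negP/negPn/eqP h0].
  by rewrite !fctE f0 h0 scaler0 addr0.
by rewrite finite_setU.
Qed.

Lemma finsupp_indic1 (R : realType) (T : choiceType) (u : T) :
  finite_set [set x | (\1_[set u] : T -> Cplx R) x != 0].
Proof.
apply: (@sub_finite_set _ _ [set u]) => //= x /=; apply: contra_neqP => xu.
by rewrite indicE memNset.
Qed.

(** Otherwise the sets with finite complement in [K] form a proper filter; it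
    has no cluster point, because it contains [K] minus any point and the point
    alone is a neighbourhood of itself. *)
Lemma discrete_compact_finite (T : topologicalType) (K : set T) :
  (forall x : T, open [set x]) -> compact K -> finite_set K.
Proof.
move=> open1 cK; apply: contrapT => infK.
have KF : ProperFilter [set S | finite_set (K `\` S)].
  split; first by rewrite /= setD0.
  split=> /= [|P Q fP fQ|P Q PQ]; first by rewrite setDT.
    apply: (@sub_finite_set _ _ ((K `\` P) `|` (K `\` Q))).
      by move=> x [Kx /not_andP[nP|nQ]]; [left|right].
    by rewrite finite_setU.
  by apply: sub_finite_set => x [Kx nQ]; split=> // /PQ.
have [|x [Kx clx]] := cK _ KF; first by rewrite /= setDv.
have nx : nbhs x [set x] by apply: open_nbhs_nbhs; split => //; exact: open1.
have [|y [[_ yx] /= xy]] := clx (K `\ x) [set x] _ nx; last exact: yx.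
by apply: (@sub_finite_set _ _ [set x]) => // z [Kz] /not_andP[//|/contrapT].
Qed.

(** * Fibre sums of the image of the full group ring *)

Section FullRep.
Variables (R : realType) (G : ampleGroupoidType) (cG : compact (units G)).
Local Notation C := (Cplx R).
Local Notation F := (topFullGroup cG).
Implicit Types (a b : F -> C) (g u v : G).

(** The finite support is needed: the sum of functions defining [full_rep] is 0
    when infinitely many of its terms are nonzero, even if only finitely many
    of them are nonzero at [g]. *)
Lemma full_repE a g : finite_set [set U | a U != 0] ->
  full_rep R cG a g = \sum_(U \in [set U | a U != 0]) a U * \1_(val U) g.
Proof.
move=> afin; rewrite /full_rep -(@fsbig_widen _ _ _ _ [set U | a U != 0])//=.
  by rewrite !fsbig_finite//= fct_sumE.
by move=> U [_ /= /negP/negPn/eqP ->]; rewrite scale0r.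
Qed.

Lemma full_bisection_section (U : F) u : units G u ->
  exists2 g, val U g /\ grng g = u & forall h, val U h -> grng h = u -> h = g.
Proof.
have [_ _ [rU _] rngU _] := topFullGroupP U.
rewrite -rngU => -[g Ug gu]; exists g; first by [].
by move=> h Uh hu; apply: rU; rewrite ?inE// gu.
Qed.

(** Every full bisection has exactly one arrow with range [u] and therefore
    contributes its coefficient exactly once, whatever the unit [u] is. *)
Lemma fiber_sum_full_rep a u : finite_set [set U | a U != 0] -> units G u ->
  \sum_(g \in [set g | grng g = u]) full_rep R cG a g =
  \sum_(U \in [set U | a U != 0]) a U.
Proof.
set S := [set U | a U != 0] => afin Uu.
have /choice[sec secP] (U : F) : exists g, [/\ val U g, grng g = u &
    forall h, val U h -> grng h = u -> h = g].
  by have [g [? ?] ?] := full_bisection_section U Uu; exists g.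
have fS : finite_set (sec @` S) by exact: finite_image.
rewrite -(@fsbig_widen _ _ _ _ (sec @` S))//=; last 2 first.
- by move=> _ [U _ <-] /=; case: (secP U).
- move=> g [/= gu gS]; rewrite full_repE//; apply: fsbig1 => U SU.
  rewrite indicE memNset ?mulr0// => Ug; apply: gS; exists U => //.
  by have [_ _ /(_ g Ug gu)] := secP U.
under eq_fsbigr do rewrite full_repE//.
rewrite exchange_fsbig//; apply: eq_fsbigr => U; rewrite inE => SU.
(* [U] meets the fibre of [u] in the single point [sec U] *)
rewrite -mulr_fsumr -[RHS]mulr1; congr (_ * _).
have [Us su sP] := secP U.
rewrite -(@fsbig_widen _ _ _ _ [set sec U])//=.
- by rewrite fsbig_set1 indicE mem_set.
- by move=> _ ->; exists U.
- move=> _ [[V SV <-] /= VU]; rewrite indicE memNset// => UV; apply: VU.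
  by apply: sP => //; case: (secP V).
Qed.

(** The unit space is open and Hausdorff, and the compact open bisections form
    a basis. *)
Lemma separating_bisection u v : units G u -> units G v -> u != v ->
  exists B : set G, [/\ compact B, open B, bisection B, B `<=` units G &
    B u /\ ~ B v].
Proof.
move=> Uu Uv uv.
have := @groupoid_hausdorff G.
rewrite open_hausdorff => /(_ u v uv)[[P Q] /= [Pu Qv] [oP oQ PQ0]].
have oPU : open (P `&` units G) by apply: openI => //; exact: open_units.
have [_ /(_ u (P `&` units G))] := @ample_basis G.
case; first by apply: open_nbhs_nbhs; split=> //; split=> //; rewrite -inE.
move=> B [[cB oB bB] Bu] BPU; exists B; split=> //.
- by move=> g /BPU[].
- split=> // Bv; move/eqP : PQ0; apply/eqP/set0P; exists v; split.
    by have [] := BPU _ Bv.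
  by rewrite -inE.
Qed.

Lemma is_group_units : (forall u v, units G u -> units G v -> u = v) ->
  is_group G.
Proof.
move=> uv; have [g] : inhabited G by exact: groupoid_inhabited.
exists (grng g); apply/seteqP; split=> [u Uu|_ ->]; last exact: units_rng.
by apply: uv => //; exact: units_rng.
Qed.

Lemma steinberg_indic (B : set G) : compact B -> open B -> bisection B ->
  sa_set (steinberg_algebra R G) \1_B.
Proof.
move=> cB oB bB; exists 1%N, (fun=> 1), (fun=> B); split=> //.
by rewrite big_ord_recl big_ord0 addr0 scale1r.
Qed.

(** A preimage of the characteristic function of a separating bisection would
    have the sum of its coefficients equal to both 1 and 0. *)
Lemma full_rep_surj_is_group :
  star_iso (full_group_ring R cG) (steinberg_algebra R G) (full_rep R cG) ->
  is_group G.
Proof.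
move=> [_ [_ _ surj]]; apply: is_group_units => u v Uu Uv.
apply/eqP/negPn/negP => uv.
have [B [cB oB bB BU [Bu nBv]]] := separating_bisection Uu Uv uv.
have [a /= afin aB] := surj _ (steinberg_indic cB oB bB).
have fiberB w : units G w ->
    \sum_(g \in [set g | grng g = w]) (\1_B g : C) = \1_B w.
  move=> Uw; rewrite -(@fsbig_widen _ _ _ _ [set w])//=.
  - by rewrite fsbig_set1.
  - by move=> _ ->; rewrite /= units_rngE.
  - move=> g [/= gw gnw]; rewrite indicE memNset// => Bg.
    by apply: gnw; rewrite -gw units_rngE//; exact: BU.
have := fiberB u Uu; rewrite -aB fiber_sum_full_rep//.
rewrite -(fiber_sum_full_rep afin Uv) aB fiberB//.
rewrite !indicE (mem_set Bu) (memNset nBv) => /eqP.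
by rewrite eq_sym oner_eq0.
Qed.

End FullRep.

(** * The full group of a group *)

(** The common form of the Steinberg algebra of a group and of the compactly
    supported continuous functions on a discrete groupoid. *)
Definition finsupp_algebra (R : realType) (G : ampleGroupoidType) :
    starAlgebraIn (G -> Cplx R) :=
  StarAlgebraIn [set f | finite_set [set g | f g != 0]]
    (@convolution R G) (@involution R G).

Lemma discrete_Cc (R : realType) (G : ampleGroupoidType) :
  (forall U : set G, open U) ->
  compactly_supported_algebra R G = finsupp_algebra R G.
Proof.
move=> oG; congr StarAlgebraIn; apply/seteqP; split=> f /=.
  move=> [_ [K cK fK]]; apply: (@sub_finite_set _ _ K).
    by move=> g /= fg; apply: contrapT => /fK fg0; rewrite fg0 eqxx in fg.
  by apply: discrete_compact_finite => // x; exact: oG.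
move=> fin; split; first by apply/continuousP => A _; exact: oG.
exists [set g | f g != 0]; first exact: finite_compact.
by move=> g /= /negP/negPn/eqP.
Qed.

(** A [starAlgebraIn] is only a set with operations on the ambient space; these
    are the closure properties that make it a subalgebra. *)
Definition star_closed (R : realType) (V : lmodType (Cplx R))
    (A : starAlgebraIn V) : Prop :=
  [/\ forall (k : Cplx R) u v, sa_set A u -> sa_set A v ->
        sa_set A (k *: u + v),
      forall u v, sa_set A u -> sa_set A v -> sa_set A (sa_mul A u v) &
      forall u, sa_set A u -> sa_set A (sa_star A u)].

Lemma star_closed_group_ring (R : realType) (F : groupType) :
  star_closed (group_ring R F).
Proof.
split=> /=.
- by move=> k a b fa fb; exact: finsupp_lin.
- move=> a b fa fb.
  apply: (@sub_finite_set _ _ ((fun p : F * F => (p.1 * p.2)%g) @`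
      ([set g | a g != 0] `*` [set g | b g != 0]))); last first.
    by apply: finite_image; exact: finite_setX.
  move=> g /= ab0; apply: contrapT => gn; move/eqP : ab0; apply.
  apply: fsbig1 => -[x y] /= xyg; apply/eqP/negPn/negP.
  by rewrite mulf_eq0 negb_or => /andP[a0 b0]; apply: gn; exists (x, y).
- move=> a fa.
  apply: (@sub_finite_set _ _ ((fun g => (g^-1)%g) @` [set g | a g != 0])).
    move=> g /= ag; exists (g^-1)%g; last exact: invgK.
    by move: ag; rewrite conjC_eq0.
  exact: finite_image.
Qed.

Section GroupCase.
Variables (R : realType) (G : ampleGroupoidType) (cG : compact (units G)).
Hypothesis groupG : is_group G.
Local Notation C := (Cplx R).
Local Notation F := (topFullGroup cG).
Implicit Types (a b : F -> C) (g h : G) (f : G -> C).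

Lemma group_grng g h : grng g = grng h.
Proof.
have [e Ue] := groupG.
by have := units_rng g; have := units_rng h; rewrite Ue => -> ->.
Qed.

Lemma group_srng g h : gsrc g = grng h.
Proof. by rewrite -grng_src; exact: group_grng. Qed.

(** The range map is constant on a group, so an open set on which it is
    injective is a singleton. *)
Lemma group_open1 g : open [set g].
Proof.
have [U [[oU Ug] iU _ _]] := @grng_local_homeo G g.
suff -> : [set g] = U by [].
apply/seteqP; split=> [_ -> //|h Uh].
by apply: iU; rewrite ?inE//; exact: group_grng.
Qed.

Lemma group_discrete (U : set G) : open U.
Proof.
have -> : U = \bigcup_(g in U) [set g].
  by apply/seteqP; split=> [g Ug|g [h Uh ->]//]; exists g.
by apply: bigcup_open => g _; exact: group_open1.
Qed.

Lemma group_bisection1 (B : set G) g h : bisection B -> B g -> B h -> g = h.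
Proof.
by move=> [rB _] Bg Bh; apply: rB; rewrite ?inE//; exact: group_grng.
Qed.

Lemma group_full1 g : full_bisection [set g].
Proof.
have Ur h : units G h -> h = grng g.
  by move=> /units_rngE <-; exact: group_grng.
split; [exact: compact_set1|exact: group_open1| | |].
- by split=> x y; rewrite !inE => -> ->.
- by apply/seteqP; split=> [_ [_ -> <-]|u /Ur ->]; [exact: units_rng|exists g].
- apply/seteqP; split=> [_ [_ -> <-]|u /Ur ->]; first exact: units_src.
  by exists g => //; exact: group_srng.
Qed.

Definition point_bisection g : F := exist _ [set g] (asboolT (group_full1 g)).

(** A full bisection of a group is not empty and has at most one point. *)
Lemma point_bisection_bij : bijective point_bisection.
Proof.
have /choice[sec secP] (U : F) : exists g, val U g.
  have [_ _ _ rU _] := topFullGroupP U.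
  have [g] : inhabited G by exact: groupoid_inhabited.
  by have := units_rng g; rewrite -rU => -[h Uh _]; exists h.
exists sec => [g|U]; first exact: (secP (point_bisection g)).
apply: val_inj; apply/seteqP; split=> [_ -> //|g Ug] /=.
have [_ _ bU _ _] := topFullGroupP U.
exact: group_bisection1 Ug (secP U).
Qed.

Lemma point_bisectionM g h :
  point_bisection (gmul g h) = (point_bisection g * point_bisection h)%g.
Proof.
apply: val_inj; apply/seteqP; split=> x /=.
  by move=> ->; exists g, h; split=> //; exact: group_srng.
by move=> [_ [_ [-> -> _ ->]]].
Qed.

Lemma point_bisectionV g : point_bisection (ginv g) = (point_bisection g)^-1%g.
Proof.
by apply: val_inj; rewrite /= /set_ginv image_set1.
Qed.

Lemma group_full_repE a g : finite_set [set U | a U != 0] ->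
  full_rep R cG a g = a (point_bisection g).
Proof.
move=> fa; rewrite full_repE//.
have pg (U : F) : val U g -> U = point_bisection g.
  move=> Ug; apply: val_inj; apply/seteqP; split=> [h Uh|_ -> //] /=.
  have [_ _ bU _ _] := topFullGroupP U.
  exact: group_bisection1 Uh Ug.
rewrite (@fsbig_widen _ _ _ _ _ [set: F])//=; last first.
  by move=> U [_ /= /negP/negPn/eqP ->]; rewrite mul0r.
rewrite -(@fsbig_widen _ _ _ _ [set point_bisection g])//=; last first.
  by move=> U [_ /= Ug]; rewrite indicE memNset ?mulr0// => /pg.
by rewrite fsbig_set1 indicE mem_set// mulr1.
Qed.

(** Under the identification of the full group with the group itself,
    [full_rep] becomes the identity on finitely supported functions. *)
Lemma group_ring_iso :
  star_iso (full_group_ring R cG) (finsupp_algebra R G) (full_rep R cG).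
Proof.
have [sec secK secV] := point_bisection_bij.
have [_ clM clV] := star_closed_group_ring R F.
have [clL _ _] := star_closed_group_ring R F.
have fsec (P : F -> bool) : finite_set [set U | P U] ->
    finite_set [set g | P (point_bisection g)].
  move=> fP; apply: (@sub_finite_set _ _ (sec @` [set U | P U])).
    by move=> g Pg; exists (point_bisection g).
  exact: finite_image.
split; last split.
- split=> /=.
  + move=> a fa; apply: sub_finite_set (fsec _ fa) => g /=.
    by rewrite group_full_repE.
  + move=> k a b fa fb; apply/funext => g.
    by rewrite !fctE !group_full_repE//; exact: clL.
  + move=> a b fa fb; apply/funext => g.
    rewrite group_full_repE; last exact: clM.
    rewrite /= /convolution.
    pose h (p : G * G) := (point_bisection p.1, point_bisection p.2).
    rewrite (@reindex_fsbig _ _ _ _ _ h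
      [set p | gsrc p.1 = grng p.2 /\ gmul p.1 p.2 = g]); last first.
      split.
      * by move=> [x y] [_ /= <-]; rewrite /= point_bisectionM.
      * move=> [x y] [x' y'] _ _ /(congr1 (fun p => (sec p.1, sec p.2))).
        by rewrite /h !secK.
      * move=> [U V] /= UV; exists (sec U, sec V); last by rewrite /h/= !secV.
        split; first exact: group_srng.
        by apply: (can_inj secK); rewrite point_bisectionM/= !secV.
    by apply: eq_fsbigr => p _; rewrite !group_full_repE.
  + move=> a fa; apply/funext => g.
    rewrite group_full_repE; last exact: clV.
    by rewrite /= /involution group_full_repE// point_bisectionV.
- move=> a /= fa; apply: sub_finite_set (fsec _ fa) => g /=.
  by rewrite group_full_repE.
- move=> a b; rewrite !inE /= => fa fb ab; apply/funext => U.
  by rewrite -(secV U) -!group_full_repE// ab.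
- move=> f /= ff; exists (f \o sec) => /=.
    apply: (@sub_finite_set _ _ (point_bisection @` [set g | f g != 0])).
      by move=> U /= fU; exists (sec U).
    exact: finite_image.
  apply/funext => g; rewrite group_full_repE/= ?secK//.
  apply: (@sub_finite_set _ _ (point_bisection @` [set g | f g != 0])).
    by move=> U /= fU; exists (sec U).
  exact: finite_image.
Qed.

Lemma group_steinberg : steinberg_algebra R G = finsupp_algebra R G.
Proof.
congr StarAlgebraIn; apply/seteqP; split=> f /=.
  move=> [n [k [U [cU ->]]]].
  apply: (@sub_finite_set _ _ (\bigcup_(i in [set: 'I_n]) U i)).
    move=> g /=; apply: contra_neqP => nU.
    rewrite fct_sumE big1// => i _.
    rewrite !fctE indicE memNset ?scaler0// => Ui.
    by apply: nU; exists i.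
  apply: bigcup_finite => // i _; have [+ _ _] := cU i.
  by apply: discrete_compact_finite => g; exact: group_open1.
move=> ff; have [s sf] := (finite_seqP _).1 ff.
have [t [ut st]] : exists t, uniq t /\ [set g | f g != 0] = [set` t].
  exists (undup s); rewrite undup_uniq; split=> //.
  by rewrite sf; apply/seteqP; split=> x /=; rewrite mem_undup.
exists (size t), (fun i => f (tnth (in_tuple t) i)).
exists (fun i => [set tnth (in_tuple t) i]); split.
  by move=> i; have [] := group_full1 (tnth (in_tuple t) i).
apply/funext => g; rewrite fct_sumE.
transitivity (\sum_(h <- t) f h * (\1_[set h] g : C)); last by rewrite big_tnth.
rewrite fsbig_seq// -st.
have [fg0|fg0] := eqVneq (f g) 0.
  rewrite fg0 fsbig1// => h /= fh; rewrite indicE memNset ?mulr0//= => gh.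
  by rewrite -gh fg0 eqxx in fh.
rewrite -(@fsbig_widen _ _ _ _ [set g])//=.
- by rewrite fsbig_set1 indicE mem_set// mulr1.
- by move=> _ ->.
- by move=> h [_ /= hg]; rewrite indicE memNset ?mulr0//= => gh; exact: hg.
Qed.

Lemma is_group_full_rep_iso :
  star_iso (full_group_ring R cG) (steinberg_algebra R G) (full_rep R cG).
Proof. by rewrite group_steinberg; exact: group_ring_iso. Qed.

End GroupCase.

(** * Isometries on dense sets *)

Section IsometricExtension.
Variables (K : numFieldType) (V : zmodType).
Variables (X : normedModType K) (Y : completeNormedModType K).
Variables (D : set V) (i : V -> X) (j : V -> Y).
Hypothesis ij : forall u v, D u -> D v -> `|i u - i v| = `|j u - j v|.
Hypothesis Di : dense (i @` D).

(** The trace on [D], along [i], of the neighbourhoods of [x]. The extension of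
    [j] at [x] is the limit of [j] along this filter. *)
Definition approx (x : X) : set_system V :=
  filter_from (nbhs x) (fun U => D `&` i @^-1` U).

Lemma approx_filter x : ProperFilter (approx x).
Proof.
apply: filter_from_proper.
  apply: filter_from_filter; first by exists setT; exact: filterT.
  move=> U U' xU xU'; exists (U `&` U'); first exact: filterI.
  by move=> u /= [Du [Uu U'u]].
move=> U; rewrite nbhsE => -[W [oW Wx] WU].
have [z [Wz [u Du uz]]] := Di (ex_intro _ x Wx) oW.
by exists u; split=> //; rewrite /preimage/= uz; exact: WU.
Qed.

Lemma approx_cvg x : i @ approx x --> x.
Proof. by move=> U xU; exists U => // u []. Qed.

Lemma approx_dom x : \forall u \near approx x, D u.
Proof. by exists setT; [exact: filterT | move=> u []]. Qed.

(** The map [j] sends the Cauchy filter [i @ approx x] to a Cauchy filter,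
    as it preserves distances. Recording the limit by its distances to the
    points of [j @` D] is convenient: this property determines it, and all
    further properties of the extension follow from it alone. *)
Lemma isometric_extension_point x :
  exists y, forall u, D u -> `|y - j u| = `|x - i u|.
Proof.
have FF := approx_filter x.
have cj : cauchy (j @ approx x).
  have jF : ProperFilter (j @ approx x) by exact: fmap_proper_filter.
  apply/(@cauchy_ballP K Y _ jF) => e e0; rewrite near_map2.
  have iF : ProperFilter (i @ approx x) by exact: fmap_proper_filter.
  have ic : cauchy (i @ approx x) := cvg_cauchy _ (cvgP _ (@approx_cvg x)).
  have := iffRL (@cauchy_ballP K X _ iF) (ic _) e e0.
  rewrite near_map2 => -[[P Q] /= [aP aQ] PQ].
  exists (P `&` D, Q `&` D) => /=.
    by split; apply: filterI => //; exact: approx_dom.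
  move=> [u v] /= [[Pu Du] [Qv Dv]].
  have := PQ (u, v) (conj Pu Qv).
  by rewrite /= -!ball_normE/= ij.
have /cauchy_cvg/cvg_ex[y jy] := cj.
exists y => u Du.
have jyu : `|j v - j u| @[v --> approx x] --> `|y - j u|.
  by apply: cvg_norm; apply: cvgB => //; exact: cvg_cst.
have ixu : `|i v - i u| @[v --> approx x] --> `|x - i u|.
  by apply: cvg_norm; apply: cvgB; [exact: approx_cvg|exact: cvg_cst].
apply: (cvg_unique (@norm_hausdorff _ K^o) jyu).
apply: cvg_trans ixu; apply: near_eq_cvg.
by apply: filterS (approx_dom x) => v Dv; rewrite ij.
Qed.

Lemma isometric_extension :
  exists phi : X -> Y, forall x u, D u -> `|phi x - j u| = `|x - i u|.
Proof.
by have [phi phiP] := choice isometric_extension_point; exists phi.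
Qed.

End IsometricExtension.

Section ExtensionTheory.
Variables (K : numFieldType) (V : zmodType) (X Y : normedModType K).
Variables (D : set V) (i : V -> X) (j : V -> Y) (phi : X -> Y).
Hypothesis phiP : forall x u, D u -> `|phi x - j u| = `|x - i u|.

Lemma extension_emb u : D u -> phi (i u) = j u.
Proof.
move=> Du; apply/eqP; rewrite -subr_eq0 -normr_eq0 phiP//.
by rewrite subrr normr0.
Qed.

Lemma extension_cvg (T : Type) (F : set_system T) (w : T -> V) x :
  Filter F -> (\forall t \near F, D (w t)) ->
  i (w t) @[t --> F] --> x -> j (w t) @[t --> F] --> phi x.
Proof.
move=> FF FD /cvgrPdist_le ix; apply/cvgrPdist_le => e e0.
by apply: filterS2 FD (ix e e0) => t Dt; rewrite phiP.
Qed.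

Lemma extension_isometry : dense (i @` D) ->
  forall x y, `|phi x - phi y| = `|x - y|.
Proof.
move=> Di x y; have FF := approx_filter Di y.
have jy : `|phi x - j v| @[v --> approx D i y] --> `|phi x - phi y|.
  apply: cvg_norm; apply: cvgB; first exact: cvg_cst.
  by apply: extension_cvg; [exact: approx_dom|exact: approx_cvg].
have iy : `|x - i v| @[v --> approx D i y] --> `|x - y|.
  by apply: cvg_norm; apply: cvgB; [exact: cvg_cst|exact: approx_cvg].
apply: (cvg_unique (@norm_hausdorff _ K^o) jy).
apply: cvg_trans iy; apply: near_eq_cvg.
by apply: filterS (@approx_dom _ _ _ D i y) => v Dv; rewrite phiP.
Qed.

(** The defining property is symmetric in the two sides, so the extensions of
    [j] along [i] and of [i] along [j] are inverse to each other. *)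
Lemma extension_cancel (psi : Y -> X) : dense (i @` D) ->
  (forall y u, D u -> `|psi y - i u| = `|y - j u|) -> cancel phi psi.
Proof.
move=> Di psiP x; have FF := approx_filter Di x.
apply: (cvg_unique (@norm_hausdorff _ X)) (@approx_cvg _ _ _ D i x).
apply/cvgrPdist_le => e e0.
have /cvgrPdist_le/(_ e e0) := @approx_cvg _ _ _ D i x.
apply: filterS2 (@approx_dom _ _ _ D i x) => u Du.
by rewrite psiP// phiP.
Qed.

End ExtensionTheory.

(** * Completions in the maximal norm *)

Section RealNorm.
Variables (R : realType) (V : normedModType (Cplx R)).
Implicit Types x y : V.

Lemma real_normE x : (real_norm x)%:C%C = `|x|.
Proof. by rewrite RRe_real// normr_real. Qed.

Lemma real_normZ (r : R) x : real_norm (r%:C%C *: x) = `|r| * real_norm x.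
Proof.
apply: complexI; rewrite rmorphM/= !real_normE normrZ.
by rewrite normc_def/= expr0n addr0 sqrtr_sqr.
Qed.

End RealNorm.

Section CStarContinuity.
Variables (R : realType) (A : cstarAlgebraType R).
Implicit Types x y : A.

(** The C*-identity and submultiplicativity give [|z| ^ 2 <= |z*| |z|];
    this is applied to [x] and to its adjoint. *)
Lemma csstar_norm x : `|csstar x| = `|x|.
Proof.
have le z : `|z| <= `|csstar z|.
  have [->|z0] := eqVneq z 0; first by rewrite normr0.
  rewrite -(ler_pM2r (_ : 0 < `|z|)) ?normr_gt0//.
  by rewrite -expr2 -csnorm_star csnormM.
by apply/eqP; rewrite eq_le le andbT -{2}(csstarK x) le.
Qed.

Lemma csstarB x y : csstar (x - y) = csstar x - csstar y.
Proof.
have := csstar_semilinear (-1) y x.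
by rewrite !scaleN1r rmorphN1 scaleN1r addrC => ->; rewrite addrC.
Qed.

Lemma csstar_cvg (T : Type) (F : set_system T) (f : T -> A) x : Filter F ->
  f @ F --> x -> csstar (f t) @[t --> F] --> csstar x.
Proof.
move=> FF /cvgrPdist_le fx; apply/cvgrPdist_le => e e0.
by apply: filterS (fx e e0) => t; rewrite -csstarB csstar_norm.
Qed.

Lemma csmulBl x y z : csmul (x - y) z = csmul x z - csmul y z.
Proof.
have := csmul_linearl (-1) y x z.
by rewrite !scaleN1r addrC => ->; rewrite addrC.
Qed.

Lemma csmulBr x y z : csmul z (x - y) = csmul z x - csmul z y.
Proof.
have := csmul_linearr (-1) y x z.
by rewrite !scaleN1r addrC => ->; rewrite addrC.
Qed.

Lemma csmul_cvg (T : Type) (F : set_system T) (f g : T -> A) x y : Filter F ->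
  f @ F --> x -> g @ F --> y -> csmul (f t) (g t) @[t --> F] --> csmul x y.
Proof.
move=> FF fx gy.
pose b t := `|x - f t| * `|y| + `|f t| * `|y - g t|.
have b0 : b t @[t --> F] --> (0 : Cplx R).
  rewrite [X in _ --> X](_ : 0 = `|x - x| * `|y| + `|x| * `|y - y|); last first.
    by rewrite !subrr normr0 mul0r mulr0 addr0.
  apply: cvgD; apply: cvgM; apply: cvg_norm => //; try exact: cvg_cst.
    by apply: cvgB => //; exact: cvg_cst.
  by apply: cvgB => //; exact: cvg_cst.
apply/cvgrPdist_le => e e0; move/cvgrPdist_le : b0 => /(_ e e0).
apply: filterS => t; rewrite sub0r normrN ger0_norm ?addr_ge0 ?mulr_ge0//.
apply: le_trans.
have -> : csmul x y - csmul (f t) (g t) =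
    csmul (x - f t) y + csmul (f t) (y - g t).
  by rewrite csmulBl csmulBr addrA subrK.
by rewrite (le_trans (ler_normD _ _))// lerD// csnormM.
Qed.

End CStarContinuity.

Section MaxNorm.
Variables (R : realType) (V W : lmodType (Cplx R)).
Variables (A : starAlgebraIn V) (B : starAlgebraIn W).
Implicit Types (f : V -> W) (u v : V).

Lemma star_iso_inverse f : star_closed A -> star_iso A B f ->
  exists2 g, star_hom B A g &
    (forall u, sa_set A u -> g (f u) = u) /\
    (forall w, sa_set B w -> f (g w) = w).
Proof.
move=> [Alin Amul Astar] [[fAB flin fmul fstar] [_ finj fsurj]].
have fI u v : sa_set A u -> sa_set A v -> f u = f v -> u = v.
  by move=> Au Av; apply: finj; rewrite inE.
have /choice[g gP] w : exists v, sa_set B w -> sa_set A v /\ f v = w.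
  have [/fsurj[v Av fv]|nBw] := pselect (sa_set B w); first by exists v.
  by exists 0.
have gA w : sa_set B w -> sa_set A (g w) by case/gP.
have gK w : sa_set B w -> f (g w) = w by case/gP.
have fK u : sa_set A u -> g (f u) = u.
  by move=> Au; apply: fI; rewrite ?gK//; [apply: gA|]; exact: fAB.
exists g => //; split=> //.
- move=> k u v Bu Bv; rewrite -[u in LHS]gK// -[v in LHS]gK//.
  by rewrite -flin ?fK//; [apply: Alin| |]; exact: gA.
- move=> u v Bu Bv; rewrite -[u in LHS]gK// -[v in LHS]gK//.
  by rewrite -fmul ?fK//; [apply: Amul| |]; exact: gA.
- move=> u Bu; rewrite -[u in LHS]gK//.
  by rewrite -fstar ?fK//; [apply: Astar|]; exact: gA.
Qed.

(** Every representation of [B] restricts along [f] to a representation of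
    [A]. *)
Lemma max_norm_hom f u : star_hom A B f -> sa_set A u ->
  (max_norm B (f u) <= max_norm A u)%E.
Proof.
move=> [fAB flin fmul fstar] Au; apply: le_ereal_sup.
move=> _ [H [rho [[rbnd rlin rmul rstar] ->]]]; exists H, (rho \o f).
split=> //; split=> /=.
- by move=> v Av; apply: rbnd; exact: fAB.
- by move=> k v w Av Aw x; rewrite flin// rlin//; exact: fAB.
- by move=> v w Av Aw x; rewrite fmul// rmul//; exact: fAB.
- by move=> v Av x y; rewrite fstar// rstar//; exact: fAB.
Qed.

End MaxNorm.

Lemma max_norm_iso (R : realType) (V W : lmodType (Cplx R))
    (A : starAlgebraIn V) (B : starAlgebraIn W) (f : V -> W) u :
  star_closed A -> star_iso A B f -> sa_set A u ->
  max_norm B (f u) = max_norm A u.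
Proof.
move=> Acl fiso Au; apply/eqP; rewrite eq_le; have [fhom _] := fiso.
rewrite (max_norm_hom fhom Au)/=.
have [g ghom [fK gK]] := star_iso_inverse Acl fiso.
rewrite -{1}(fK u Au) (max_norm_hom ghom)//.
by case: fhom => fAB _ _ _; exact: fAB.
Qed.

Section Completion.
Variables (R : realType) (V : lmodType (Cplx R)) (A : starAlgebraIn V).
Variable (CA : max_completion A).

Lemma completion_embB u v : sa_set A u -> sa_set A v ->
  completion_emb CA (u - v) = completion_emb CA u - completion_emb CA v.
Proof.
move=> Au Av; have [_ elin _ _] := completion_emb_hom CA.
by rewrite addrC -scaleN1r elin// scaleN1r addrC.
Qed.

End Completion.

Section CompletionIso.
Variables (R : realType) (V W : lmodType (Cplx R)).
Variables (A : starAlgebraIn V) (B : starAlgebraIn W) (f : V -> W).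
Variables (CA : max_completion A) (CB : max_completion B).
Hypotheses (Acl : star_closed A) (fiso : star_iso A B f).

Let iA := completion_emb CA.
Let jB := completion_emb CB \o f.

Let ijP u v : sa_set A u -> sa_set A v -> `|iA u - iA v| = `|jB u - jB v|.
Proof.
have [[fAB flin _ _] _] := fiso; have [Alin _ _] := Acl.
move=> Au Av; rewrite /iA /jB/= -!completion_embB//; try exact: fAB.
have Auv : sa_set A (u - v) by rewrite addrC -scaleN1r; exact: Alin.
have fB : f (u - v) = f u - f v.
  by rewrite addrC -scaleN1r flin// scaleN1r addrC.
rewrite -!real_normE; congr (_%:C%C); apply: EFin_inj.
rewrite -fB !completion_norm//; last exact: fAB.
by rewrite (max_norm_iso Acl fiso).
Qed.

Let dense_jB : dense (jB @` sa_set A).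
Proof.
have [[fAB _ _ _] [_ _ fsurj]] := fiso.
have -> : jB @` sa_set A = completion_emb CB @` sa_set B.
  apply/seteqP; split=> x [u Au <-]; first by exists (f u) => //; exact: fAB.
  by have [v Av <-] := fsurj u Au; exists v.
exact: completion_dense.
Qed.

(** The embedding of [A] into [CA] and its embedding into [CB] through [f]
    induce the same distance, so each extends along the other; the extensions
    are inverse to each other, and they are homomorphisms by continuity. *)
Lemma completion_iso : exists phi : CA -> CB,
  [/\ star_iso (full_starAlgebra CA) (full_starAlgebra CB) phi, continuous phi &
      forall a, sa_set A a ->
        phi (completion_emb CA a) = completion_emb CB (f a)].
Proof.
have Di : dense (iA @` sa_set A) by exact: completion_dense.
have [phi phiP] := isometric_extension ijP Di.
have jiP u v Au Av := esym (@ijP u v Au Av).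
have [psi psiP] := isometric_extension jiP dense_jB.
have phi_norm := extension_isometry phiP Di.
have [[fAB flin fmul fstar] _] := fiso; have [Alin Amul Astar] := Acl.
have [_ elin emul estar] := completion_emb_hom CA.
have [_ e'lin e'mul e'star] := completion_emb_hom CB.
have jB_cvg (T : Type) (F : set_system T) w x : Filter F ->
    (\forall t \near F, sa_set A (w t)) ->
    iA (w t) @[t --> F] --> x -> jB (w t) @[t --> F] --> phi x.
  exact: extension_cvg.
(* an operation on [A] that extends continuously to [q] on [CA] and to [q'] on
   [CB] is respected by [phi]; it serves for sums, products and stars *)
have ext2 (m : V -> V -> V) (q : CA -> CA -> CA) (q' : CB -> CB -> CB) :
    (forall u v, sa_set A u -> sa_set A v ->
      [/\ sa_set A (m u v), iA (m u v) = q (iA u) (iA v) &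
          jB (m u v) = q' (jB u) (jB v)]) ->
    (forall (T : Type) (F : set_system T) (g h : T -> CA) x y, Filter F ->
      g @ F --> x -> h @ F --> y -> q (g t) (h t) @[t --> F] --> q x y) ->
    (forall (T : Type) (F : set_system T) (g h : T -> CB) x y, Filter F ->
      g @ F --> x -> h @ F --> y -> q' (g t) (h t) @[t --> F] --> q' x y) ->
    forall x y, phi (q x y) = q' (phi x) (phi y).
  move=> mP qc q'c x y.
  have FF := approx_filter Di x; have FG := approx_filter Di y.
  pose F := filter_prod (approx (sa_set A) iA x) (approx (sa_set A) iA y).
  have FFG : ProperFilter F by exact: filter_prod_proper.
  have FD : \forall p \near F, sa_set A p.1 /\ sa_set A p.2.
    by exists (sa_set A, sa_set A); [split; exact: approx_dom|case].
  have FD1 : \forall p \near F, sa_set A p.1 by apply: filterS FD => p [].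
  have FD2 : \forall p \near F, sa_set A p.2 by apply: filterS FD => p [].
  have i1 : iA p.1 @[p --> F] --> x.
    by apply: (cvg_comp fst iA); [exact: cvg_fst|exact: approx_cvg].
  have i2 : iA p.2 @[p --> F] --> y.
    by apply: (cvg_comp snd iA); [exact: cvg_snd|exact: approx_cvg].
  have Fm : \forall p \near F, sa_set A (m p.1 p.2).
    by apply: filterS FD => p [A1 A2]; case: (mP _ _ A1 A2).
  have im : iA (m p.1 p.2) @[p --> F] --> q x y.
    apply: cvg_trans (qc _ _ _ _ _ _ _ i1 i2); apply: near_eq_cvg.
    by apply: filterS FD => p [A1 A2]; case: (mP _ _ A1 A2).
  apply: (cvg_unique (@norm_hausdorff _ CB) (jB_cvg _ _ _ _ _ Fm im)).
  apply: cvg_trans (q'c _ _ _ _ _ _ _ (jB_cvg _ _ _ _ _ FD1 i1)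
    (jB_cvg _ _ _ _ _ FD2 i2)); apply: near_eq_cvg.
  by apply: filterS FD => p [A1 A2]; case: (mP _ _ A1 A2).
have phiK := extension_cancel phiP Di psiP.
exists phi; split; last exact: extension_emb phiP.
- split; last first.
    split=> //; first by move=> x y _ _; exact: can_inj phiK _ _.
    move=> y _; exists (psi y) => //.
    exact: (extension_cancel psiP dense_jB phiP).
  split=> //.
  + move=> k x y _ _.
    apply: (ext2 (fun u v => k *: u + v) (fun u v => k *: u + v)
       (fun u v => k *: u + v)).
    * move=> u v Au Av; rewrite /iA /jB/=; split; [exact: Alin|exact: elin|].
      by rewrite flin// e'lin//; exact: fAB.
    * by move=> T F g h a b FF ga hb; apply: cvgD => //; exact: cvgZr.
    * by move=> T F g h a b FF ga hb; apply: cvgD => //; exact: cvgZr.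
  + move=> x y _ _; apply: (ext2 (sa_mul A) csmul csmul).
    * move=> u v Au Av; rewrite /iA /jB/=; split; [exact: Amul|exact: emul|].
      by rewrite fmul// e'mul//; exact: fAB.
    * by move=> T F g h a b FF; exact: csmul_cvg.
    * by move=> T F g h a b FF; exact: csmul_cvg.
  + move=> x _.
    apply: (ext2 (fun u _ => sa_star A u) (fun u _ => csstar u)
      (fun u _ => csstar u) _ _ _ x x).
    * move=> u v Au Av; rewrite /iA /jB/=; split; [exact: Astar|exact: estar|].
      by rewrite fstar// e'star//; exact: fAB.
    * by move=> T F g h a b FF ga _; exact: csstar_cvg.
    * by move=> T F g h a b FF ga _; exact: csstar_cvg.
- move=> x; apply/cvgrPdist_le => e e0.
  have /cvgrPdist_le/(_ e e0) := @cvg_id _ (nbhs x).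
  by apply: filterS => y; rewrite phi_norm.
Qed.

End CompletionIso.

Section GroupCompletion.
Variables (R : realType) (G : ampleGroupoidType) (cG : compact (units G)).
Hypothesis groupG : is_group G.

Lemma is_group_full_rep_max_iso (CF : full_group_cstar R cG)
    (CG : groupoid_cstar R G) :
  star_iso (full_starAlgebra CF) (full_starAlgebra CG) (full_rep_max CF CG).
Proof.
have iso : star_iso (full_group_ring R cG) (compactly_supported_algebra R G)
    (full_rep R cG).
  by rewrite discrete_Cc; [exact: group_ring_iso|exact: group_discrete].
have [phi [phi_iso phi_cont phiE]] :=
  completion_iso CF CG
    (@star_closed_group_ring R (topFullGroup cG)) iso.
suff -> : full_rep_max CF CG = phi by [].
rewrite /full_rep_max.
case: xgetP => [psi _ [_ psi_cont psiE]|/(_ phi)]; last first.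
  by case; split=> //; case: phi_iso.
apply/funext => x.
pose A := sa_set (full_group_ring R cG).
have FF := approx_filter (@completion_dense _ _ _ CF) x.
have ix := @approx_cvg _ _ _ A (completion_emb CF) x.
apply: (cvg_unique (@norm_hausdorff _ CG) (cvg_comp _ _ ix (psi_cont x))).
apply: cvg_trans (cvg_comp _ _ ix (phi_cont x)); apply: near_eq_cvg.
apply: filterS (@approx_dom _ _ _ _ (completion_emb CF) x) => a fa /=.
by rewrite phiE// psiE.
Qed.

End GroupCompletion.

(** * Finite-dimensional Hilbert spaces *)

Lemma Cplx_complete (R : realType) (F : set_system (Cplx R)) :
  ProperFilter F -> cauchy F -> cvg F.
Proof.
move=> FF /cauchy_ballP Fc.
have cvgc (f : Cplx R -> R) : {morph f : z w / z - w} ->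
    (forall z, (`|f z|)%:C%C <= `|z|) -> exists l : R, f z @[z --> F] --> l.
  move=> fB fle; suff : cvg (f @ F) by move=> cf; exists (lim (f @ F)).
  have fF : ProperFilter (f @ F) by exact: fmap_proper_filter.
  apply: (@cauchy_cvg R _ fF); apply/(@cauchy_ballP R R _ fF) => e e0.
  have e0' : 0 < e%:C%C :> Cplx R by rewrite ltcR.
  rewrite near_map2.
  apply: filterS (Fc _ e0') => -[z w] /= zw.
  by rewrite /ball/= -fB -ltcR (le_lt_trans (fle _)).
have [a Fa] : exists l : R, complex.Re z @[z --> F] --> l.
  apply: cvgc => [[a b] [c d]//|z]; exact: normc_ge_Re.
have [b Fb] : exists l : R, complex.Im z @[z --> F] --> l.
  apply: cvgc => [[a' b'] [c d]//|z].
  rewrite -normrN -ReiNIm (le_trans (normc_ge_Re _))//.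
  by rewrite normrM complexiE normCi mulr1.
apply/cvg_ex; exists (a +i* b)%C; apply/cvgrPdist_le => e e0.
have eR : (complex.Re e)%:C%C = e by apply: RRe_real; exact: gtr0_real.
have e2 : 0 < complex.Re e / 2 by rewrite divr_gt0// -ltcR eR.
near=> z.
have za : `|a - complex.Re z| <= complex.Re e / 2.
  by near: z; move/cvgrPdist_le : Fa; exact.
have zb : `|b - complex.Im z| <= complex.Re e / 2.
  by near: z; move/cvgrPdist_le : Fb; exact.
rewrite [(a +i* b)%C - z]complexE (le_trans (ler_normD _ _))//.
rewrite -eR [complex.Re e]splitr rmorphD/= lerD//.
  rewrite normc_def/= expr0n addr0 sqrtr_sqr lecR.
  by move: za; clear; case: z.
rewrite normrM complexiE normCi mul1r.
rewrite normc_def/= expr0n addr0 sqrtr_sqr lecR.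
by move: zb; clear; case: z.
Unshelve. all: by end_near. Qed.

(** A synonym of the type of column vectors, because the latter already carries
    the supremum norm. *)
Definition euclid (R : realType) (n : nat) := 'cV[Cplx R]_n.

HB.instance Definition _ (R : realType) (n : nat) :=
  GRing.Lmodule.copy (euclid R n) 'cV[Cplx R]_n.

Definition euclid_dot (R : realType) n (x y : euclid R n) : Cplx R :=
  \sum_i x i 0 * (y i 0)^*.

Section Euclid.
Variables (R : realType) (n : nat).
Local Notation C := (Cplx R).
Local Notation E := (euclid R n).
Implicit Types x y : E.

Lemma euclid_dot_bilinear :
  bilinear_for *%R (@Num.conj C \; *%R) (@euclid_dot R n).
Proof.
split=> z k x y; rewrite /euclid_dot /= !mulr_sumr -big_split/=;
  apply: eq_bigr => i _; rewrite !mxE.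
- by rewrite mulrDl mulrA.
- by rewrite rmorphD rmorphM mulrDr mulrCA.
Qed.

HB.instance Definition _ := bilinear_isBilinear.Build C E E C *%R
  (@Num.conj C \; *%R) (@euclid_dot R n) euclid_dot_bilinear.

Lemma euclid_dot_hermitian x y :
  euclid_dot x y = (-1) ^+ false * (euclid_dot y x)^*.
Proof.
rewrite expr0 mul1r /euclid_dot rmorph_sum/=; apply: eq_bigr => i _.
by rewrite rmorphM/= conjCK mulrC.
Qed.

HB.instance Definition _ := isHermitianSesquilinear.Build C E false
  (@Num.conj C) (@euclid_dot R n) euclid_dot_hermitian.

Lemma euclid_dot_gt0 x : x != 0 -> 0 < euclid_dot x x.
Proof.
move=> /cV0Pn[i xi]; rewrite /euclid_dot (bigD1 i)//=.
rewrite ltr_pwDl -?normCK ?exprn_gt0 ?normr_gt0//.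
by apply: sumr_ge0 => j _; rewrite -normCK exprn_ge0.
Qed.

HB.instance Definition _ := isDotProduct.Build C E (@euclid_dot R n)
  euclid_dot_gt0.

Definition euclid_form : {dot E for (@Num.conj C)} := @euclid_dot R n.

Definition euclid_norm x : C := sqrtC (euclid_dot x x).

Lemma euclid_normD x y : euclid_norm (x + y) <= euclid_norm x + euclid_norm y.
Proof. by case: (triangle_lerif euclid_form x y). Qed.

Lemma euclid_normZ (k : C) x : euclid_norm (k *: x) = `|k| * euclid_norm x.
Proof.
rewrite /euclid_norm (dnormZ euclid_form) sqrtCM ?nnegrE ?exprn_ge0//.
  by rewrite sqrCK.
Qed.

Lemma euclid_norm_eq0 x : euclid_norm x = 0 -> x = 0.
Proof.
by move/eqP; rewrite (sqrt_dnorm_eq0 euclid_form) => /eqP.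
Qed.

HB.instance Definition _ := Lmodule_isNormed.Build C E
  euclid_normD euclid_normZ euclid_norm_eq0.

Lemma euclid_normE x : `|x| ^+ 2 = euclid_dot x x.
Proof. by rewrite sqrtCK. Qed.

Lemma euclid_coord_le x i : `|x i 0| <= `|x|.
Proof.
rewrite -(@ler_pXn2r _ 2) ?nnegrE// euclid_normE /euclid_dot.
rewrite (bigD1 i)//= normCK lerDl; apply: sumr_ge0 => j _.
by rewrite -normCK exprn_ge0.
Qed.

Lemma euclid_le_sum x : `|x| <= \sum_i `|x i 0|.
Proof.
rewrite -(@ler_pXn2r _ 2) ?nnegrE ?sumr_ge0// euclid_normE /euclid_dot.
rewrite expr2 mulr_suml; apply: ler_sum => i _.
rewrite -normCK expr2 ler_wpM2l// (bigD1 i)//= lerDl.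
exact: sumr_ge0.
Qed.

(** The norm lies between each coordinate and the sum of the coordinates in
    absolute value, so convergence is coordinatewise. *)
Lemma euclid_complete (F : set_system E) :
  ProperFilter F -> cauchy F -> cvg F.
Proof.
move=> FF /cauchy_ballP Fc.
have coord_cvg i : exists l : C, ((fun x : E => x i 0 : C) @ F) --> l.
  suff : cvg ((fun x : E => x i 0 : C) @ F) by move=> /cvg_ex.
  have fF : ProperFilter ((fun x : E => x i 0 : C) @ F).
    exact: fmap_proper_filter.
  apply: Cplx_complete; apply/(@cauchy_ballP C C _ fF) => e e0.
  rewrite near_map2.
  apply: filterS (Fc _ e0) => -[x y] /= xy.
  have xyi : x i 0 - y i 0 = (x - y) i 0 by rewrite !mxE.
  by rewrite /ball/= xyi (le_lt_trans (euclid_coord_le _ _)).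
have [l Fl] := choice coord_cvg.
apply/cvg_ex; exists (\col_i l i); apply/cvgrPdist_le => e e0.
have en : 0 < e / n.+1%:R by rewrite divr_gt0// ltr0n.
have near_l : \forall x \near F, forall i, `|l i - (x : E) i 0| <= e / n.+1%:R.
  by apply: filter_forall => i; move/cvgrPdist_le : (Fl i); exact.
apply: filterS near_l => x xl; rewrite (le_trans (euclid_le_sum _))//.
apply: (@le_trans _ _ (\sum_(i < n) e / n.+1%:R)).
  by apply: ler_sum => i _; rewrite !mxE.
rewrite sumr_const card_ord -[_ *+ n]mulr_natr -mulrA ler_piMr ?(ltW e0)//.
by rewrite ler_pdivrMl ?ltr0n// mulr1 ler_nat.
Qed.

HB.instance Definition _ := Uniform_isComplete.Build E euclid_complete.
HB.instance Definition _ := isHilbert.Build R E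
  (euclid_normE : forall x : E, `|x| ^+ 2 = euclid_form x x).

End Euclid.

(** * The trivial representation of a discrete groupoid *)

(** The enumeration [e] of the units turns functions on the unit space into
    column vectors. *)
Section TrivialRepresentation.
Variables (R : realType) (G : ampleGroupoidType) (n : nat) (e : 'I_n -> G).
Hypothesis e_inj : injective e.
Hypothesis e_units : units G = range e.
Local Notation C := (Cplx R).
Local Notation E := (euclid R n).
Implicit Types (f h : G -> C).

(** The matrix of the trivial representation. Summing [f] over the arrows
    between two fixed units first keeps the operator linear in the vector for
    every [f], even where the finitely supported sums have no meaning. *)
Definition arrow_matrix f : 'M[C]_n :=
  \matrix_(i, j) \sum_(g \in [set g | (grng g == e i) && (gsrc g == e j)]) f g.

Definition trivial_rep f (x : E) : E := arrow_matrix f *m x.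

Lemma trivial_rep_linear f : linear (trivial_rep f).
Proof. by move=> k x y; rewrite /trivial_rep mulmxDr scalemxAr. Qed.

HB.instance Definition _ f :=
  GRing.isLinear.Build C E E *:%R (trivial_rep f) (trivial_rep_linear f).

Lemma arrow_matrix_seq (p : seq G) f i j : uniq p ->
  (forall x, f x != 0 -> x \in p) -> arrow_matrix f i j =
  \sum_(g <- p) f g * ((grng g == e i) && (gsrc g == e j))%:R.
Proof. by move=> up fp; rewrite mxE (fsum_seq _ up fp). Qed.

Lemma arrow_matrix_linear (k : C) f h :
  finite_set [set g | f g != 0] -> finite_set [set g | h g != 0] ->
  arrow_matrix (k *: f + h) = k *: arrow_matrix f + arrow_matrix h.
Proof.
move=> ff fh.
have [p up fp] := finsupp_seq ff; have [q uq hq] := finsupp_seq fh.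
have upq := undup_uniq (p ++ q); set s := undup _ in upq.
have fs x : f x != 0 -> x \in s by rewrite mem_undup mem_cat => /fp ->.
have hs x : h x != 0 -> x \in s.
  by rewrite mem_undup mem_cat => /hq ->; rewrite orbT.
have fhs x : (k *: f + h) x != 0 -> x \in s.
  apply: contraR => xs; have [f0 h0] : f x = 0 /\ h x = 0.
    by split; apply/eqP; move: xs; apply: contraNT;
      first [exact: fs|exact: hs].
  by rewrite !fctE f0 h0 scaler0 addr0.
apply/matrixP => i j; rewrite [RHS]mxE [X in _ = X + _]mxE.
rewrite !(arrow_matrix_seq _ _ upq)// mulr_sumr -big_split/=.
by apply: eq_bigr => g _; rewrite !fctE mulrDl -mulrA.
Qed.

(** The source of [x] is the unit [e i] for exactly one [i]. *)
Lemma units_indic_sum x y :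
  \sum_(i < n) ((gsrc x == e i) && (grng y == e i))%:R =
  (gsrc x == grng y)%:R :> C.
Proof.
have [i _ ei] : range e (gsrc x) by rewrite -e_units; exact: units_src.
rewrite (bigD1 i)//= big1 ?addr0; first by rewrite ei eqxx/= eq_sym.
by move=> j ji; rewrite -ei (inj_eq e_inj) eq_sym (negbTE ji).
Qed.

(** Both sides are the sum of [f x * h y] over the composable pairs
    [(x, y)] with the prescribed range and source: on the left they are
    grouped by their product, on the right by the unit at which they meet. *)
Lemma arrow_matrixM f h :
  finite_set [set g | f g != 0] -> finite_set [set g | h g != 0] ->
  arrow_matrix (convolution f h) = arrow_matrix f *m arrow_matrix h.
Proof.
move=> ff fh.
have [p up fp] := finsupp_seq ff; have [q uq hq] := finsupp_seq fh.
have convE g : convolution f h g = \sum_(x <- p) \sum_(y <- q)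
    f x * h y * ((gsrc x == grng y) && (gmul x y == g))%:R.
  rewrite /convolution; pose pq := [seq (x, y) | x <- p, y <- q].
  have upq : uniq pq by apply: allpairs_uniq => // -[? ?] [? ?].
  rewrite (_ : [set z | gsrc z.1 = grng z.2 /\ gmul z.1 z.2 = g] =
     [set z : G * G | (gsrc z.1 == grng z.2) && (gmul z.1 z.2 == g)]).
    rewrite (fsum_seq _ upq) ?big_allpairs//.
    move=> [x y] /=; rewrite mulf_eq0 negb_or => /andP[/fp xp /hq yq].
    by apply/allpairsP; exists (x, y).
  apply/seteqP; split=> -[x y] /=; first by move=> [-> ->]; rewrite !eqxx.
  by move=> /andP[/eqP ? /eqP].
have urs := undup_uniq [seq gmul x y | x <- p, y <- q]; set s := undup _ in urs.
have sP x y : x \in p -> y \in q -> gmul x y \in s.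
  by move=> xp yq; rewrite mem_undup; apply/allpairsP; exists (x, y).
have convs g : convolution f h g != 0 -> g \in s.
  apply: contraR => gs; rewrite convE big_seq big1// => x xp.
  rewrite big_seq big1// => y yq.
  case: andP => [[_ /eqP xyg]|]; last by rewrite mulr0.
  by move: gs; rewrite -xyg sP.
apply/matrixP => i k; rewrite [RHS]mxE (arrow_matrix_seq _ _ urs)//.
transitivity (\sum_(x <- p) \sum_(y <- q) f x * h y *
    ((gsrc x == grng y) && ((grng x == e i) && (gsrc y == e k)))%:R).
  under eq_bigr do rewrite convE mulr_suml.
  rewrite exchange_big/= big_seq [RHS]big_seq; apply: eq_bigr => x xp.
  under eq_bigr do rewrite mulr_suml.
  rewrite exchange_big/= big_seq [RHS]big_seq; apply: eq_bigr => y yq.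
  under eq_bigr do rewrite -mulrA.
  rewrite -mulr_sumr; congr (_ * _).
  rewrite (bigD1_seq (gmul x y)) ?sP//= big1 ?addr0; last first.
    by move=> g /negbTE gxy; rewrite [_ == g]eq_sym gxy andbF mul0r.
  rewrite eqxx andbT.
  have [sr|_] := eqVneq (gsrc x) (grng y); last by rewrite mul0r.
  by rewrite grngM// gsrcM// mul1r.
under [RHS]eq_bigr do
  rewrite (arrow_matrix_seq _ _ up)// (arrow_matrix_seq _ _ uq)// mulr_suml.
rewrite [RHS]exchange_big/=; apply: eq_bigr => x _.
under [RHS]eq_bigr do rewrite mulr_sumr.
rewrite [RHS]exchange_big/=; apply: eq_bigr => y _.
rewrite -mulnb natrM -units_indic_sum mulr_suml mulr_sumr.
apply: eq_bigr => j _.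
rewrite -!mulnb !natrM; ring.
Qed.

Lemma arrow_matrix_star f i j : finite_set [set g | f g != 0] ->
  arrow_matrix (involution f) i j = (arrow_matrix f j i)^*.
Proof.
move=> ff; have [p up fp] := finsupp_seq ff.
rewrite (arrow_matrix_seq j i up fp) rmorph_sum mxE /=.
rewrite (@reindex_fsbig _ _ _ _ _ (@ginv G)
  [set g | (grng g == e j) && (gsrc g == e i)]); last first.
  split.
  - by move=> g /= /andP[gj gi]; rewrite grngV gsrcV gi gj.
  - by move=> g h _ _ /(congr1 (@ginv G)); rewrite !ginvK.
  - move=> g /= /andP[gi gj]; exists (ginv g); last exact: ginvK.
    by rewrite /= grngV gsrcV gi gj.
rewrite (fsum_seq _ up) => [|x].
  by apply: eq_bigr => g _; rewrite /involution ginvK rmorphM/= rmorph_nat.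
by rewrite /involution ginvK conjC_eq0; exact: fp.
Qed.

Lemma trivial_rep_bounded f : bounded_operator (trivial_rep f : E -> E).
Proof.
pose M : C := \sum_i \sum_j `|arrow_matrix f i j|.
have M0 : 0 <= M by apply: sumr_ge0 => i _; exact: sumr_ge0.
exists (complex.Re M) => x.
rewrite -lecR rmorphM/= !real_normE RRe_real ?ger0_real//.
rewrite (le_trans (euclid_le_sum _))// mulr_suml; apply: ler_sum => i _.
rewrite mxE (le_trans (ler_norm_sum _ _ _))// mulr_suml; apply: ler_sum => j _.
by rewrite normrM ler_wpM2l// euclid_coord_le.
Qed.

Lemma trivial_rep_adjoint f (x y : E) : finite_set [set g | f g != 0] ->
  hdot (trivial_rep (involution f) x) y = hdot x (trivial_rep f y).
Proof.
move=> ff; rewrite /hdot/= /euclid_form /euclid_dot.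
under eq_bigr do rewrite mxE mulr_suml.
rewrite exchange_big/=; apply: eq_bigr => j _.
rewrite mxE rmorph_sum mulr_sumr; apply: eq_bigr => i _.
by rewrite arrow_matrix_star// rmorphM/=; ring.
Qed.

Lemma trivial_rep_star_representation :
  star_representation (finsupp_algebra R G)
    (fun f => trivial_rep f : {linear E -> E}).
Proof.
split=> /=.
- by move=> f _; exact: trivial_rep_bounded.
- move=> k f h ff fh x.
  by rewrite /trivial_rep arrow_matrix_linear// mulmxDl scalemxAl.
- by move=> f h ff fh x; rewrite /trivial_rep arrow_matrixM// mulmxA.
- by move=> f ff x y; exact: trivial_rep_adjoint.
Qed.

(** This is how the trivial representation sees the fibre sums. *)
Lemma trivial_rep_ones f i : finite_set [set g | f g != 0] ->
  trivial_rep f (const_mx 1) i 0 = \sum_(g \in [set g | grng g == e i]) f g.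
Proof.
move=> ff; have [p up fp] := finsupp_seq ff.
rewrite mxE (fsum_seq _ up)//.
under eq_bigr do rewrite (arrow_matrix_seq _ _ up)// mxE mulr1.
rewrite exchange_big/=; apply: eq_bigr => g _.
rewrite -mulr_sumr; congr (_ * _).
have s1 := units_indic_sum g (gsrc g).
rewrite grng_src eqxx mulr1n in s1.
rewrite -[RHS]mulr1 -[X in _ = _ * X]s1 mulr_sumr; apply: eq_bigr => j _.
by rewrite -natrM mulnb andbb.
Qed.

End TrivialRepresentation.

(** * Discrete groupoids with several units *)

Section DiscreteNonGroup.
Variables (R : realType) (G : ampleGroupoidType) (cG : compact (units G)).
Hypothesis discG : forall U : set G, open U.
Local Notation C := (Cplx R).
Local Notation F := (topFullGroup cG).
Implicit Types (a b : F -> C) (f h : G -> C).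

Lemma finite_full_rep a : finite_set [set U | a U != 0] ->
  finite_set [set g | full_rep R cG a g != 0].
Proof.
move=> fa.
apply: (@sub_finite_set _ _ (\bigcup_(U in [set U | a U != 0]) val U)).
  move=> g /= ag; apply: contrapT => ng; move/eqP : ag; apply.
  rewrite full_repE//; apply: fsbig1 => U /= aU.
  by rewrite indicE memNset ?mulr0// => Ug; apply: ng; exists U.
apply: bigcup_finite => // U _; have [cU _ _ _ _] := topFullGroupP U.
by apply: discrete_compact_finite => // g; exact: discG.
Qed.

(** The difference maps the constant vector 1 to a vector with coordinates
    [1 - c] at [u] and [- c] at [v], where [c] is the sum of the
    coefficients of [a]. Whatever [c] is, the norm of this vector is at least
    1/2, which bounds the operator norm from below after division by the norm
    of the vector 1. *)
Lemma max_norm_full_rep_gap u v : units G u -> units G v -> u != v ->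
  exists2 d : R, 0 < d & forall a, finite_set [set U | a U != 0] ->
    (d%:E <= max_norm (finsupp_algebra R G)
       ((\1_[set u] : G -> C) - full_rep R cG a))%E.
Proof.
move=> Uu Uv uv.
have [n [e e_inj e_units]] : exists n, exists2 e : 'I_n -> G, injective e &
    units G = range e.
  have fU : finite_set (units G).
    by apply: discrete_compact_finite => // g; exact: discG.
  have [s sU] := (finite_seqP _).1 fU.
  have us := undup_uniq s; pose t := in_tuple (undup s).
  exists (size (undup s)), (tnth t); first by apply/tuple_uniqP.
  rewrite sU; apply/seteqP; split=> g /=.
    by rewrite -mem_undup => /(@tnthP _ _ t)[i ->]; exists i.
  by move=> [i _ <-]; rewrite -mem_undup; exact: mem_tnth.
have [iu _ eu] : range e u by rewrite -e_units.
have [iv _ ev] : range e v by rewrite -e_units.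
pose one : euclid R n := const_mx 1.
have one0 : 0 < real_norm one.
  rewrite -ltcR RRe_real ?normr_real// normr_gt0.
  by apply/eqP => /matrixP/(_ iu 0); rewrite !mxE => /eqP; rewrite oner_eq0.
exists ((2 * real_norm one)^-1); first by rewrite invr_gt0 mulr_gt0.
move=> a fa; set f := _ - _.
have fd := @finsupp_indic1 R _ u.
have fr := finite_full_rep fa.
have ff : finite_set [set g | f g != 0].
  have -> : f = (-1) *: full_rep R cG a + \1_[set u] by rewrite scaleN1r addrC.
  exact: finsupp_lin.
pose c : C := \sum_(U \in [set U | a U != 0]) a U.
have fib i : trivial_rep e f one i 0 = (u == e i)%:R - c.
  have [_ lin _ _] := trivial_rep_star_representation R e_inj e_units.
  have -> : f = (-1) *: full_rep R cG a + \1_[set u] by rewrite scaleN1r addrC.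
  rewrite lin// mxE [X in X + _]mxE !trivial_rep_ones//.
  have eqE : [set g | grng g == e i] = [set g | grng g = e i].
    by apply/seteqP; split=> g /=; [move/eqP|move=> ->].
  rewrite !eqE fiber_sum_full_rep//; last by rewrite e_units; exists i.
  rewrite mulN1r addrC; congr (_ - _).
  have [uei|uei] := eqVneq u (e i).
    rewrite -(@fsbig_widen _ _ _ _ [set u])//=.
    - by rewrite fsbig_set1 indicE mem_set.
    - by move=> _ ->; rewrite /= units_rngE.
    - by move=> g [_ /= gu]; rewrite indicE memNset.
  apply: fsbig1 => g /= gi; rewrite indicE memNset//= => gu.
  by move: uei; rewrite -gi gu units_rngE// eqxx.
(* [x] is the constant vector normalised to length 1 *)
pose x : euclid R n := (real_norm one)^-1%:C%C *: one.
pose rho f : {linear euclid R n -> euclid R n} := trivial_rep e f.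
apply: (@le_trans _ _ (operator_norm (rho f))); last first.
  apply: ereal_sup_ubound; exists (euclid R n), rho.
  by split=> //; exact: trivial_rep_star_representation.
apply: (@le_trans _ _ (real_norm (trivial_rep e f x))%:E); last first.
  apply: ereal_sup_ubound; exists x => //=.
  by rewrite /= real_normZ gtr0_norm ?invr_gt0// mulVf// gt_eqF.
rewrite lee_fin /x linearZ/= real_normZ gtr0_norm ?invr_gt0//.
rewrite invfM mulrC ler_pM2l ?invr_gt0// -lecR real_normE.
set y := trivial_rep e f one.
have : `|y iu 0 - y iv 0| <= `|y| + `|y|.
  by rewrite (le_trans (ler_normB _ _))// lerD// euclid_coord_le.
rewrite /y !fib eu ev eqxx (negbTE uv) sub0r opprK subrK normr1 => le1.
rewrite fmorphV rmorph_nat -[_^-1]mulr1 ler_pdivrMl ?ltr0n//.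
by rewrite mulr_natl mulr2n.
Qed.

(** By density and continuity, every element in the range of [full_rep_max] is
    a limit of elements of the image of the group ring. *)
Lemma full_rep_max_surj_is_group (CF : full_group_cstar R cG)
    (CG : groupoid_cstar R G) :
  star_iso (full_starAlgebra CF) (full_starAlgebra CG) (full_rep_max CF CG) ->
  is_group G.
Proof.
move=> [_ [_ _ surj]]; apply: is_group_units => u v Uu Uv.
apply/eqP/negPn/negP => uv.
have [d d0 gap] := max_norm_full_rep_gap Uu Uv uv.
set del : G -> C := \1_[set u] in gap.
have CcE := discrete_Cc R discG.
have fdel : sa_set (compactly_supported_algebra R G) del.
  by rewrite CcE; exact: finsupp_indic1.
have far a : sa_set (full_group_ring R cG) a ->
    d%:C%C <= `|completion_emb CG del - completion_emb CG (full_rep R cG a)|.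
  move=> fa.
  have fra : sa_set (compactly_supported_algebra R G) (full_rep R cG a).
    by rewrite CcE; exact: finite_full_rep.
  rewrite -completion_embB// -real_normE lecR -lee_fin completion_norm.
    by rewrite CcE; exact: gap.
  by rewrite CcE addrC -scaleN1r in fdel fra *; exact: finsupp_lin.
have [x _] := surj (completion_emb CG del) I.
pose A := sa_set (full_group_ring R cG); pose i := completion_emb CF.
rewrite /full_rep_max.
case: xgetP => [psi _ [_ psi_cont psiE] psix|_ /= zero_del].
  have FF := approx_filter (@completion_dense _ _ _ CF) x.
  have := cvg_comp _ _ (@approx_cvg _ _ _ A i x) (psi_cont x).
  rewrite psix => /cvgrPdist_lt/(_ d%:C%C) near_d.
  have {}near_d : \forall a \near approx A i x,
      `|completion_emb CG del - psi (i a)| < d%:C%C.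
    by apply: near_d; rewrite ltcR.
  have [a [/= fa ad]] := filter_ex (filterI (@approx_dom _ _ _ A i x) near_d).
  by move: (far a fa); rewrite -psiE// => /(lt_le_trans ad); rewrite ltxx.
(* here [full_rep_max] is the constant 0; being onto it would make [del] vanish
   in [CG], at distance 0 from the image of [a = 0] *)
have fr0 : sa_set (full_group_ring R cG) (0 : F -> C).
  rewrite /= (_ : [set g | _] = set0)//.
  by apply/seteqP; split=> g //=; rewrite eqxx.
have := far 0 fr0.
have -> : full_rep R cG 0 = 0.
  by apply/funext => g; rewrite full_repE// fsbig1// => U _; rewrite mul0r.
have emb0 : completion_emb CG (0 : G -> C) = 0.
  have [_ elin _ _] := completion_emb_hom CG.
  by have := elin (-1) _ _ fdel fdel; rewrite !scaleN1r !addNr.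
by rewrite emb0 subr0 -zero_del normr0 lecR leNgt d0.
Qed.

End DiscreteNonGroup.

Theorem corollary5p6 (R : realType) (G : ampleGroupoidType)
    (cG : compact (units G)) :
  (star_iso (full_group_ring R cG) (steinberg_algebra R G)
     (full_rep R cG) <-> is_group G) /\
  ((forall U : set G, open U) ->
   forall (CF : full_group_cstar R cG) (CG : groupoid_cstar R G),
     (star_iso (full_starAlgebra CF) (full_starAlgebra CG)
        (full_rep_max CF CG) <-> is_group G)).
Proof.
split.
  split; first exact: full_rep_surj_is_group.
  exact: is_group_full_rep_iso.
move=> discG CF CG; split; first exact: full_rep_max_surj_is_group.
by move=> groupG; exact: is_group_full_rep_max_iso.
Qed.
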